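(* Suppose all assumptions of the previous result hold, namely: (A1)–(A4); $P^\star\in\Pi_{K^\star}\setminus\Pi_{K^\star-1}$, $K^\star<\infty$; for every $\theta\in\Theta_\infty$, $H(P_\theta|P^\star)<\infty$ and $p_\theta\ell_\theta\in L^1(\mu)$; $\{\ell_\theta:\theta\in\Theta_\infty\}\subset\mathcal L_\tau(P^\star)$; for every $K$, every $Q\in\mathcal Q$ and every small $\varepsilon>0$ there is a finite $T\subset\Theta_K$ with $\sup_{\theta\in\Theta_K}\min_{t\in T}|Q\ell_\theta-Q\ell_t|\le\varepsilon$; $u-l\in\mathcal M_\tau(P^\star)$; and for every $K\le K^\star$, $\theta\mapsto\ell_\theta(z)$ is differentiable on the interior of $\Theta_K$ with derivative $\dot\ell_\theta$ whose coordinates lie in $\mathcal M_\tau(P^\star)$ and $|\ell_{\theta+h}-\ell_\theta-\dot\ell_\theta^Th|\le F\cdot o(h)$ for some $F\in\mathcal L_\tau(P^\star)$. Suppose moreover that $\Pi_{K^\star}$ is an exponential model: $\mathcal Z\subset\mathbb R^q$, $\mu$ is Lebesgue measure, and $p_\theta(z)=h(z)\exp(\theta^Tt(z)-\phi(\theta))$ for $\theta\in\Theta_{K^\star}$, where $t:\mathcal Z\to\mathbb R^{K^\star}$ and $h\ge0$ are measurable, $\phi(\theta)=\log\int h\,e^{\theta^Tt}d\mu$, and $\Theta_{K^\star}$ is a convex subset of the (open) natural parameter space $\{\theta\in\mathbb R^{K^\star}:\int h\,e^{\theta^Tt}d\mu<\infty\}$ (with $\Theta_K\subset\Theta_{K^\star}$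 for $K<K^\star$). Then $$\limsup_{n\to\infty}n^{-1}\log P^\star\{\widehat K_n^G<K^\star\}\le-H(\Pi_{K^\star-1}|P^\star).$$
   Context: Setting: $(\mathcal Z,\mathcal F)$ is a Polish space with its Borel $\sigma$-field and $\mu$ a $\sigma$-finite measure on it. $Z_1,Z_2,\dots$ are i.i.d. $\mathcal Z$-valued random variables with common law $P^\star\ll\mu$, density $p^\star$, $\ell^\star=\log p^\star$; $P^\star$ also denotes the law of the whole sequence. $\{(\Theta_K,d)\}_{K\ge1}$ is an increasing (nested) sequence of metric spaces (here subsets of Euclidean spaces with norm distance), $\Theta_\infty=\bigcup_K\Theta_K$; for $\theta\in\Theta_\infty$, $P_\theta$ is a probability measure with density $p_\theta$ w.r.t. $\mu$ and $\ell_\theta=\log p_\theta$. $\Pi_K=\{P_\theta:\theta\in\Theta_K\}$, $\Pi_0=\emptyset$. The order of $P^\star$ is $K^\star=\min\{K:P^\star\in\Pi_K\}$. $\lambda f=\int f\,d\lambda$. $H(P|Q)=\int\log(dP/dQ)\,dP$ if $P\ll Q$ and $+\infty$ otherwise; $H(\Pi|Q)=\inf_{P\in\Pi}H(P|Q)$. Given a penalty $\mathrm{pen}(n,K)>0$, $\mathrm{crit}(n,K)=\sup_{\theta\in\Theta_K}\sum_{i=1}^n\ell_\theta(Z_i)-\mathrm{pen}(n,K)$ and $\widehat K_n^G$ is the smallest maximizer of $K\mapsto\mathrm{crit}(n,K)$. All suprema are assumed measurable. Standing assumptions: (A1) each $(\Theta_K,d)$ is compact and each $\Pi_K$ is compact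 for the weak topology; (A2) for each $z$ and $K$, $\theta\mapsto\ell_\theta(z)$ is continuous on $\Theta_K$; (A3) there are $l,u:\mathcal Z\to\mathbb R$ with $u-l\in L^1(P^\star)$, $l\le\ell^\star\le u$ and $l\le\ell_\theta\le u$ for all $\theta\in\Theta_\infty$; (A4) for each $n$, $\mathrm{pen}(n,\cdot)$ is increasing, and for each $K$, $\mathrm{pen}(n,K)\to\infty$ and $\mathrm{pen}(n,K)=o(n)$ as $n\to\infty$. Large-deviation framework: $\tau(s)=e^{|s|}-|s|-1$. $\mathcal L_\tau(P^\star)=\{f:\mathcal Z\to\mathbb R:\exists a>0,\ P^\star\tau(f/a)<\infty\}$ and $\mathcal M_\tau(P^\star)=\{f:\forall a>0,\ P^\star\tau(f/a)<\infty\}$; $\mathcal L_\tau(P^\star)$ is a Banach space with the norm $\|f\|_\tau=\inf\{a>0:P^\star\tau(f/a)\le1\}$, and $\mathcal L'_\tau(P^\star)$ is its topological dual. $\mathcal P=\{p^{-1}\sum_{i=1}^p\delta_{z_i}:p\ge1,z_i\in\mathcal Z\}$. $\mathcal Q=\{Q\in\mathcal L'_\tau(P^\star):Q\ge0,\ Q1=1\}\cup\mathcal P$. *)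

(* Defs.v *)
From HB Require Import structures.
From mathcomp Require Import all_boot all_order all_algebra.
From mathcomp Require Import all_classical all_reals all_analysis.
From mathcomp Require Import measurable_realfun.
Set Implicit Arguments. Unset Strict Implicit. Unset Printing Implicit Defensive.
Import Order.TTheory GRing.Theory Num.Theory.
Import numFieldNormedType.Exports.
Local Open Scope classical_set_scope.
Local Open Scope ring_scope.

Definition tau {R : realType} (s : R) : R := expR `|s| - `|s| - 1.

Definition dotr {R : realType} (n : nat) (x y : 'rV[R]_n) : R :=
  \sum_(i < n) x ord0 i * y ord0 i.

Definition tdist {R : realType} (q : nat) (x y : q.-tuple R) : R :=
  \big[Num.max/0]_(i < q) `|tnth x i - tnth y i|.

Definition polish_subset {R : realType} (q : nat) (Zs : set (q.-tuple R)) : Prop :=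
  exists dd : q.-tuple R -> q.-tuple R -> R,
    [/\ ((forall x y, Zs x -> Zs y -> 0 <= dd x y /\ (dd x y = 0 <-> x = y)) /\
         (forall x y, Zs x -> Zs y -> dd x y = dd y x) /\
         (forall x y z, Zs x -> Zs y -> Zs z -> dd x z <= dd x y + dd y z)),
        (* same topology as the Euclidean subspace topology *)
        (forall x, Zs x ->
           (forall e, 0 < e -> exists2 d, 0 < d &
              forall y, Zs y -> tdist x y < d -> dd x y < e) /\
           (forall e, 0 < e -> exists2 d, 0 < d &
              forall y, Zs y -> dd x y < d -> tdist x y < e)),
        (forall u : nat -> q.-tuple R, (forall n, Zs (u n)) ->
           (forall e, 0 < e -> exists N, forall m n, (N <= m)%N -> (N <= n)%N ->
              dd (u m) (u n) < e) ->
           exists2 x, Zs x & forall e, 0 < e -> exists N, forall n, (N <= n)%N ->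
              dd (u n) x < e) &
        exists D : set (q.-tuple R), [/\ countable D, D `<=` Zs &
           forall x e, Zs x -> 0 < e -> exists2 y, D y & dd x y < e]].

Definition is_lebesgue {R : realType} (q : nat)
  (mu : {measure set (q.-tuple R) -> \bar R}) : Prop :=
  forall a b : q.-tuple R,
    mu [set x | forall i, tnth a i < tnth x i <= tnth b i] =
    (\prod_(i < q) Num.max 0 (tnth b i - tnth a i))%:E.

Section Model.
Context {R : realType} (q : nat) (Zs : set (q.-tuple R))
        (mu : {measure set (q.-tuple R) -> \bar R}).
Local Notation T := (q.-tuple R).

Definition dlaw (f : T -> R) (A : set T) : \bar R :=
  \int[mu]_(z in A `&` Zs) (f z)%:E.

Definition is_density (f : T -> R) : Prop :=
  [/\ measurable_fun Zs f, (forall z, Zs z -> 0 <= f z) & dlaw f setT = 1%E].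

Definition Pint (pstar : T -> R) (f : T -> R) : \bar R :=
  \int[mu]_(z in Zs) (f z * pstar z)%:E.

Definition L1P (pstar : T -> R) (f : T -> R) : Prop :=
  mu.-integrable Zs (fun z => (f z * pstar z)%:E).

Definition Ltau (pstar : T -> R) (f : T -> R) : Prop :=
  measurable_fun Zs f /\
  exists2 a : R, 0 < a & (Pint pstar (fun z => tau (f z / a)) < +oo)%E.

Definition Mtau (pstar : T -> R) (f : T -> R) : Prop :=
  measurable_fun Zs f /\
  forall a : R, 0 < a -> (Pint pstar (fun z => tau (f z / a)) < +oo)%E.

Definition tau_norm (pstar : T -> R) (f : T -> R) : R :=
  inf [set a : R | 0 < a /\ (Pint pstar (fun z => tau (f z / a)) <= 1)%E].

Definition Pnull (pstar : T -> R) (N : set T) : Prop :=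
  measurable N /\ dlaw pstar N = 0%E.

Definition Pae_eq (pstar : T -> R) (f g : T -> R) : Prop :=
  exists2 N, Pnull pstar N & forall z, Zs z -> ~ N z -> f z = g z.

(* Q is a nonnegative element of the topological dual of L_tau(P^* ) with Q1 = 1,
   represented as a functional on functions, meaningful on L_tau(P^* ). *)
Definition in_dual_Q (pstar : T -> R) (Q : (T -> R) -> R) : Prop :=
  [/\ (forall f g a b, Ltau pstar f -> Ltau pstar g ->
         Q (fun z => a * f z + b * g z) = a * Q f + b * Q g),
      (forall f g, Ltau pstar f -> Ltau pstar g -> Pae_eq pstar f g -> Q f = Q g),
      (exists C : R, forall f, Ltau pstar f -> `|Q f| <= C * tau_norm pstar f),
      (forall f, Ltau pstar f -> (forall z, Zs z -> 0 <= f z) -> 0 <= Q f) &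
      Q (fun _ => 1) = 1].

Definition empirical_Q (Q : (T -> R) -> R) : Prop :=
  exists s : seq T, [/\ (0 < size s)%N, (forall z, z \in s -> Zs z) &
    forall f, Q f = (\sum_(z <- s) f z) / (size s)%:R].

Definition in_calQ (pstar : T -> R) (Q : (T -> R) -> R) : Prop :=
  in_dual_Q pstar Q \/ empirical_Q Q.

Definition relent (f g : T -> R) : \bar R :=
  if `[< forall A, measurable A -> dlaw g A = 0%E -> dlaw f A = 0%E >]
  then (\int[mu]_(z in Zs) (f z * ln (f z / g z))%:E)%E
  else +oo%E.

End Model.

Definition relent_set {R : realType} (q : nat) (Zs : set (q.-tuple R))
  (mu : {measure set (q.-tuple R) -> \bar R}) (Th : Type)
  (p : Th -> q.-tuple R -> R) (Theta : set Th) (pstar : q.-tuple R -> R) : \bar R :=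
  ereal_inf [set relent Zs mu (p th) pstar | th in Theta].

Definition in_Pi {R : realType} (q : nat) (Zs : set (q.-tuple R))
  (mu : {measure set (q.-tuple R) -> \bar R}) (Th : Type)
  (p : Th -> q.-tuple R -> R) (Theta : set Th) (f : q.-tuple R -> R) : Prop :=
  exists2 th, Theta th & forall A, measurable A -> dlaw Zs mu (p th) A = dlaw Zs mu f A.

(* continuity on Theta_K of a function of theta, Theta_K carrying the norm distance
   of its Euclidean coordinates crd *)
Definition cont_on {R : realType} (Th : Type) (m : nat) (crd : Th -> 'rV[R]_m)
  (S : set Th) (g : Th -> R) : Prop :=
  forall th0, S th0 -> forall e : R, 0 < e -> exists2 d : R, 0 < d &
    forall th, S th -> `|crd th - crd th0| < d -> `|g th - g th0| < e.

Definition is_o_at0 {R : realType} (m : nat) (r : 'rV[R]_m -> R) : Prop :=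
  forall e : R, 0 < e -> exists2 d : R, 0 < d &
    forall h, `|h| < d -> `|r h| <= e * `|h|.

Definition convex_set {R : realType} (m : nat) (S : set 'rV[R]_m) : Prop :=
  forall x y (l : R), S x -> S y -> 0 <= l <= 1 -> S (l *: x + (1 - l) *: y).

Definition loglik {R : realType} (T Th : Type) (p : Th -> T -> R) (n : nat)
  (z : nat -> T) (th : Th) : R := \sum_(i < n) ln (p th (z i)).

Definition crit {R : realType} (T Th : Type) (p : Th -> T -> R) (Theta : nat -> set Th)
  (pen : nat -> nat -> R) (n K : nat) (z : nat -> T) : \bar R :=
  (ereal_sup [set (loglik p n z th)%:E | th in Theta K] - (pen n K)%:E)%E.

(* the event {hat K_n^G < Kstar}: the smallest maximizer of K |-> crit(n,K) is < Kstar,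
   i.e. some maximizer is < Kstar *)
Definition Khat_lt {R : realType} (T Th Omega : Type) (p : Th -> T -> R)
  (Theta : nat -> set Th) (pen : nat -> nat -> R) (Z : nat -> Omega -> T)
  (n Kstar : nat) : set Omega :=
  [set w | exists K, (K < Kstar)%N /\
     forall K', (crit p Theta pen n K' (fun i => Z i w) <= crit p Theta pen n K (fun i => Z i w))%E].

Definition nlog {R : realType} (n : nat) (a : \bar R) : \bar R :=
  if a == 0%E then -oo%E else ((n%:R)^-1 * ln (fine a))%:E.

(* Main.v *)
Require Import Defs.
From HB Require Import structures.
From mathcomp Require Import all_boot all_order all_algebra.
From mathcomp Require Import all_classical all_reals all_analysis.
From mathcomp Require Import measurable_realfun.
From mathcomp Require Import ring lra.
Set Implicit Arguments. Unset Strict Implicit. Unset Printing Implicit Defensive.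
Import Order.TTheory GRing.Theory Num.Theory.
Import numFieldNormedType.Exports HBNNSimple.
Local Open Scope classical_set_scope.
Local Open Scope ring_scope.

(** Write [x] for a coordinate of [Theta Kstar], [x0] for that of the true law, [T] for
    the empirical mean of [t] and [phi] for the log-partition function.
    Underestimation forces some [x'] coming from [Theta Kstar.-1] to maximize
    [x.T - phi x] over [Theta Kstar] up to [pen(n, Kstar) / n = o(1)].  By
    convexity [x'] can be compared with [x' + s (x0 - x')], and this confines [T]
    to the half-space
    [(x' - x0).T >= (phi x' - phi (x' + s (x0 - x'))) / s - o(1)].  Its Chernoff
    exponent is [(phi x' - phi (x' + s (x0 - x'))) / s - phi x' + phi x0], which
    tends to [H(P_x' | P_x0)] as [s] decreases to [0].  Exponential tightness of
    [T] and compactness reduce the union over [x'] to a finite one. *)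

(** The step [s] stays positive inside the events because a near-maximizer is neither exact nor
    interior, so no first-order condition is available, whereas comparison with one point of the
    segment needs only convexity of the parameter set. The limit in [s] is taken in the exponent
    alone, at the centre of each ball of the finite cover, so [s] never varies with the sample. The
    Chernoff tilt [x' - x0] is not optimized: it turns the density at [x0] into the one at [x'],
    under which the mean of [(x' - x0).t] is the limiting threshold of the half-space, so in the
    limit no exponent is lost. *)

(** * Expectations under independence and the Chernoff bound *)

(** Simple functions and monotone convergence. The two weights let one lemma serve both independence
    (remaining factors against a constant) and change of law (weight one against a density). *)
Lemma ge0_integral_indic_transfer (R : realType) (d1 d2 d : measure_display)
  (T1 : measurableType d1) (T2 : measurableType d2) (T : measurableType d)
  (m1 : {measure set T1 -> \bar R}) (m2 : {measure set T2 -> \bar R})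
  (D1 : set T1) (D2 : set T2) (W1 : T1 -> R) (W2 : T2 -> R)
  (X1 : T1 -> T) (X2 : T2 -> T) :
  measurable D1 -> measurable D2 ->
  measurable_fun D1 W1 -> measurable_fun D2 W2 ->
  (forall x, D1 x -> 0 <= W1 x) -> (forall x, D2 x -> 0 <= W2 x) ->
  measurable_fun D1 X1 -> measurable_fun D2 X2 ->
  (forall A, measurable A ->
     (\int[m1]_(x in D1) (W1 x * \1_A (X1 x))%:E =
      \int[m2]_(x in D2) (W2 x * \1_A (X2 x))%:E)%E) ->
  forall g : T -> R, measurable_fun setT g -> (forall y, 0 <= g y) ->
  (\int[m1]_(x in D1) (W1 x * g (X1 x))%:E =
   \int[m2]_(x in D2) (W2 x * g (X2 x))%:E)%E.
Proof.
move=> mD1 mD2 mW1 mW2 W10 W20 mX1 mX2 H g mg g0.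
have mEg : measurable_fun setT (EFin \o g) by exact/measurable_EFinP.
pose f := nnsfun_approx measurableT mEg.
have fcvg (d' : measure_display) (T' : measurableType d')
    (m : {measure set T' -> \bar R})
    (D : set T') (W : T' -> R) (X : T' -> T) : measurable D ->
    measurable_fun D W -> (forall x, D x -> 0 <= W x) -> measurable_fun D X ->
    (\int[m]_(x in D) (W x * f n (X x))%:E @[n --> \oo] -->
     \int[m]_(x in D) (W x * g (X x))%:E)%E.
  move=> mD mW W0 mX.
  have H1 : forall x, D x ->
      ((W x * f n (X x))%:E @[n --> \oo] --> (W x * g (X x))%:E)%E.
    move=> x Dx; under eq_fun do rewrite EFinM; rewrite EFinM.
    apply: cvgeZl => //.
    by apply: (@cvg_nnsfun_approx _ _ _ _ measurableT _ mEg) => // y _ /=; rewrite lee_fin.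
  rewrite (_ : (\int[m]_(x in D) (W x * g (X x))%:E)%E =
     (\int[m]_(x in D) limn (fun n => (W x * f n (X x))%:E))%E); last first.
    apply: eq_integral => x; rewrite inE => Dx; apply/esym/cvg_lim => //.
    exact: H1.
  apply: cvg_monotone_convergence => //.
  - move=> n; apply/measurable_EFinP; apply: measurable_funM => //.
    by apply: (@measurable_comp _ _ _ _ _ _ setT).
  - by move=> n x Dx; rewrite lee_fin mulr_ge0 // W0.
  - move=> x Dx m' n mn; rewrite lee_fin ler_wpM2l ?W0 //.
    by have := nd_nnsfun_approx measurableT mEg mn => /lefP; apply.
have fE (d' : measure_display) (T' : measurableType d')
    (m : {measure set T' -> \bar R})
    (D : set T') (W : T' -> R) (X : T' -> T) n : measurable D ->
    measurable_fun D W -> (forall x, D x -> 0 <= W x) -> measurable_fun D X ->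
    (\int[m]_(x in D) (W x * f n (X x))%:E =
     \sum_(y \in range (f n)) (y%:E *
        \int[m]_(x in D) (W x * \1_(f n @^-1` [set y]) (X x))%:E))%E.
  move=> mD mW W0 mX.
  have mA y : measurable_fun D (fun x => W x * \1_(f n @^-1` [set y]) (X x)).
    apply: measurable_funM => //.
    by apply: (@measurable_comp _ _ _ _ _ _ setT).
  transitivity (\int[m]_(x in D) (\sum_(y \in range (f n))
     (y * (W x * \1_(f n @^-1` [set y]) (X x)))%:E))%E.
    apply: eq_integral => x _.
    rewrite fsumEFin // fimfunE; congr EFin.
    rewrite !fsbig_finite // mulr_sumr; apply: eq_bigr => y _.
    by rewrite mulrCA.
  rewrite ge0_integral_fsum //; last 2 first.
  - by move=> y; apply/measurable_EFinP; apply: measurable_funM.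
  (* Nonnegativity is required at every real [y], not only on the range; for negative [y] the level
     set is empty. *)
  - move=> y x Dx; have [y0|y0] := leP 0 y.
      by rewrite lee_fin !mulr_ge0 ?W0.
    rewrite indicE memNset ?mulr0 //= => /= e.
    by move: y0; rewrite -e ltNge fun_ge0.
  apply: eq_fsbigr => y; rewrite inE => -[z _ <-].
  under eq_integral do rewrite EFinM.
  rewrite ge0_integralZl_EFin //.
  - by move=> x Dx; rewrite lee_fin mulr_ge0 ?W0.
  - exact/measurable_EFinP.
have := fcvg _ _ m1 D1 W1 X1 mD1 mW1 W10 mX1.
have := fcvg _ _ m2 D2 W2 X2 mD2 mW2 W20 mX2.
have -> : (fun n => \int[m2]_(x in D2) (W2 x * f n (X2 x))%:E)%E =
          (fun n => \int[m1]_(x in D1) (W1 x * f n (X1 x))%:E)%E.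
  apply/funext => n; rewrite !fE //; apply: eq_fsbigr => y _.
  by rewrite H.
by move=> c2 c1; rewrite -(cvg_lim _ c1) // -(cvg_lim _ c2).
Qed.

(* Independence is known on rectangles; the indicators are replaced by the [g i]
   one index at a time. *)
Lemma integral_prod_indep (R : realType) (dO d : measure_display)
  (Omega : measurableType dO) (P : probability Omega R)
  (T : measurableType d) (Z : nat -> Omega -> T) (n : nat)
  (g : nat -> T -> R) (M : nat -> R) :
  (forall i, measurable_fun setT (Z i)) ->
  (forall A : nat -> set T, (forall i, measurable (A i)) ->
     P (\bigcap_(i < n) Z i @^-1` A i) =
     (\prod_(i < n) fine (P (Z i @^-1` A i)))%:E) ->
  (forall i, measurable_fun setT (g i)) -> (forall i y, 0 <= g i y) ->
  (forall i, \int[P]_w (g i (Z i w))%:E = (M i)%:E)%E ->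
  (\int[P]_w (\prod_(i < n) g i (Z i w))%:E = (\prod_(i < n) M i)%:E)%E.
Proof.
move=> mZ indep.
(* Only the first [k] factors may be arbitrary, the later ones being indicators: [k = 0] is the
   rectangle formula and [k = n] the claim. *)
suff S (k : nat) : forall (g : nat -> T -> R) (M : nat -> R), (forall i, measurable_fun setT (g i)) ->
    (forall i y, 0 <= g i y) ->
    (forall i, \int[P]_w (g i (Z i w))%:E = (M i)%:E)%E ->
    (forall i, (k <= i < n)%N -> exists2 A, measurable A & g i = \1_A) ->
    (\int[P]_w (\prod_(i < n) g i (Z i w))%:E = (\prod_(i < n) M i)%:E)%E.
  move=> mg g0 gM; apply: (S n) => // i /andP[ni ni'].
  by move: ni'; rewrite ltnNge ni.
have mZA i (A : set T) : measurable A -> measurable (Z i @^-1` A).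
  by move=> mA; rewrite -[X in measurable X]setTI; exact: mZ.
elim: k => [|k IH] {}g {}M mg g0 gM gA.
  have /choice[A HA] : forall i, exists A : set T,
      measurable A /\ ((i < n)%N -> g i = \1_A).
    move=> i; case: (ltnP i n) => [ni|ni].
      by have [A mA ->] := gA i ni; exists A.
    by exists setT.
  have mA i : measurable (A i) by case: (HA i).
  have gE i : (i < n)%N -> g i = \1_(A i) by case: (HA i).
  have -> : \prod_(i < n) M i = \prod_(i < n) fine (P (Z i @^-1` A i)).
    apply: eq_bigr => i _; have := gM i; rewrite gE //.
    rewrite [X in X = _ -> _](_ : _ = \int[P]_w (\1_(Z i @^-1` A i) w)%:E)%E //.
    by rewrite integral_indic // ?setIT => [->//|]; exact: mZA.
  rewrite -indep //.
  transitivity (\int[P]_w (\1_(\bigcap_(i < n) Z i @^-1` A i) w)%:E)%E; last first.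
    rewrite integral_indic // ?setIT //.
    by apply: bigcap_measurableType => i _; exact: mZA.
  apply: eq_integral => w _; congr EFin.
  have [cw|ncw] := pselect ((\bigcap_(i < n) Z i @^-1` A i) w).
    rewrite indicE mem_set //= big1 // => i _; rewrite gE // indicE mem_set //.
    exact: (cw i (ltn_ord i)).
  rewrite [RHS]indicE memNset //=.
  have /existsNP[i /not_implyP[ni nA]] := ncw.
  rewrite (bigD1 (Ordinal ni)) //= gE // indicE memNset ?mul0r //.
have [nk|kn] := leqP n k.
  by apply: IH => // i /andP[ki ni]; move: ni; rewrite ltnNge (leq_trans nk).
(* All factors except the [k]-th are frozen into a weight, so that [g k] may be replaced by an
   indicator, where the induction hypothesis applies. *)
pose W w := \prod_(i < n | i != Ordinal kn) g i (Z i w).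
pose c := \prod_(i < n | i != Ordinal kn) M i.
have M0 i : 0 <= M i.
  by rewrite -lee_fin -gM integral_ge0 // => w _; rewrite lee_fin.
have mgZ i : measurable_fun setT (fun w => g i (Z i w)).
  exact: (@measurable_comp _ _ _ _ _ _ setT).
have c0 : 0 <= c by apply: prodr_ge0.
have W0 w : 0 <= W w by apply: prodr_ge0.
have mW : measurable_fun setT W.
  rewrite /W; under eq_fun do rewrite -big_filter.
  by apply: measurable_prod => i _.
transitivity (\int[P]_w (W w * g k (Z k w))%:E)%E.
  by apply: eq_integral => w _; rewrite (bigD1 (Ordinal kn)) //= mulrC.
rewrite (@ge0_integral_indic_transfer _ _ _ _ _ Omega _ P P _ setT _ (cst c) _ (Z k)) //.
  rewrite (bigD1 (Ordinal kn)) //= mulrC; under eq_integral do rewrite EFinM.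
  rewrite ge0_integralZl_EFin //; first by rewrite gM EFinM.
  - by move=> w _; rewrite lee_fin.
  - exact/measurable_EFinP.
move=> A mA.
have mk : measurable (Z k @^-1` A) by exact: mZA.
have kA : (\int[P]_w (\1_A (Z k w))%:E = (fine (P (Z k @^-1` A)))%:E)%E.
  rewrite [LHS](_ : _ = \int[P]_w (\1_(Z k @^-1` A) w)%:E)%E //.
  by rewrite integral_indic // setIT fineK // fin_num_measure.
under [RHS]eq_integral do rewrite EFinM.
rewrite ge0_integralZl_EFin //; last first.
  by apply/measurable_EFinP; apply: (@measurable_comp _ _ _ _ _ _ setT).
rewrite [X in (_ * X)%E]kA -EFinM.
pose g' i := if i == k then \1_A else g i.
pose M' i := if i == k then fine (P (Z k @^-1` A)) else M i.
have -> : c * fine (P (Z k @^-1` A)) = \prod_(i < n) M' i.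
  rewrite (bigD1 (Ordinal kn)) //= {1}/M' eqxx mulrC; congr (_ * _).
  by apply: eq_bigr => i; rewrite /M' -val_eqE /= => /negbTE ->.
rewrite -(IH g' M').
- apply: eq_integral => w _; rewrite (bigD1 (Ordinal kn)) //= {1}/g' eqxx mulrC.
  congr (_ * _)%:E; apply: eq_bigr => i; rewrite /g' -val_eqE /= => /negbTE ->.
  by [].
- by move=> i; rewrite /g'; case: ifP.
- by move=> i y; rewrite /g'; case: ifP.
- by move=> i; rewrite /g' /M'; case: ifP => [/eqP ->//|].
- move=> i /andP[]; rewrite /g' leq_eqVlt eq_sym; case: ifP => [_ _ _|_ /= ki ni].
    by exists A.
  by apply: gA; rewrite ki.
Qed.

Lemma measurable_sum_ge (R : realType) (dO d : measure_display)
  (Omega : measurableType dO) (T : measurableType d)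
  (Z : nat -> Omega -> T) (f : T -> R) (n : nat) (a : R) :
  (forall i, measurable_fun setT (Z i)) -> measurable_fun setT f ->
  measurable [set w | a <= \sum_(i < n) f (Z i w)].
Proof.
move=> mZ mf.
have mS : measurable_fun setT (fun w => \sum_(i < n) f (Z i w)).
  by apply: measurable_sum => i; apply: (@measurable_comp _ _ _ _ _ _ setT).
have := mS measurableT `[a, +oo[%classic (measurable_itv _).
rewrite setTI; congr measurable; apply/seteqP; split => w /=;
  by rewrite in_itv /= andbT.
Qed.

(** Exponential Markov inequality: on the event, the product of the [expR (f (Z i w) - a)] is at
    least one, and its expectation factors. *)
Lemma chernoff_iid (R : realType) (dO d : measure_display)
  (Omega : measurableType dO) (P : probability Omega R)
  (T : measurableType d) (Z : nat -> Omega -> T) (f : T -> R) (m : R)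
  (n : nat) (a : R) :
  (forall i, measurable_fun setT (Z i)) ->
  (forall A : nat -> set T, (forall i, measurable (A i)) ->
     P (\bigcap_(i < n) Z i @^-1` A i) =
     (\prod_(i < n) fine (P (Z i @^-1` A i)))%:E) ->
  measurable_fun setT f ->
  (forall i, \int[P]_w (expR (f (Z i w)))%:E = m%:E)%E ->
  (P [set w | (n%:R * a <= \sum_(i < n) f (Z i w))%R] <= ((expR (- a) * m) ^+ n)%:E)%E.
Proof.
move=> mZ indep mf fm.
set E := [set w | _].
have mE : measurable E by exact: (measurable_sum_ge n (n%:R * a) mZ mf).
have mef (b : R) : measurable_fun setT (fun y => expR (f y - b)).
  by apply: measurableT_comp => //; apply: measurable_funB.
have mfZ i : measurable_fun setT (fun w => expR (f (Z i w))).
  apply: measurableT_comp => //.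
  by apply: (@measurable_comp _ _ _ _ _ _ setT).
have -> : (((expR (- a) * m) ^+ n)%:E =
    \int[P]_w (\prod_(i < n) expR (f (Z i w) - a))%:E)%E.
  rewrite (@integral_prod_indep _ _ _ _ P _ Z n (fun _ y => expR (f y - a))
     (fun=> expR (- a) * m)) //.
    by rewrite prodr_const card_ord.
  move=> i; under eq_integral do rewrite addrC expRD EFinM.
  rewrite ge0_integralZl_EFin ?expR_ge0 //.
  - by rewrite fm EFinM.
  - exact/measurable_EFinP.
rewrite -[E]setIT -integral_indic //.
apply: ge0_le_integral => //.
- exact/measurable_EFinP.
- apply/measurable_EFinP; apply: measurable_prod => i _.
  exact: (measurableT_comp (mef a) (mZ i)).
move=> w _; rewrite lee_fin -expR_sum indicE; case: (boolP (w \in E)) => [|_] /=; last first.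
  by rewrite expR_ge0.
rewrite inE /E /= => aw; rewrite -expR0 ler_expR sumrB sumr_const card_ord.
by rewrite subr_ge0 -mulr_natl.
Qed.

(** * The one-sided derivative of a moment generating function *)

(** Convexity of the exponential; it bounds [(expR (s * y) - 1) / s] above by [expR y - 1],
    uniformly in [s], as dominated convergence requires. *)
Lemma expR_chord (R : realType) (s y : R) :
  0 <= s <= 1 -> expR (s * y) <= 1 - s + s * expR y.
Proof.
move=> /andP[s0 s1]; set c := expR (s * y).
(* the tangent at [s * y], evaluated at [y] and at [0] *)
have c0 : 0 <= c by exact: expR_ge0.
have e1 : c * (1 + (1 - s) * y) <= expR y.
  have -> : expR y = c * expR ((1 - s) * y) by rewrite -expRD; congr expR; ring.
  by rewrite ler_wpM2l ?expR_ge1Dx.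
have e0 : c * (1 - s * y) <= 1.
  rewrite -[leRHS](expRxMexpNx_1 (s * y)).
  by rewrite ler_wpM2l ?expR_ge1Dx.
have h1 : s * (c * (1 + (1 - s) * y)) <= s * expR y by exact: ler_wpM2l.
have h2 : (1 - s) * (c * (1 - s * y)) <= (1 - s) * 1.
  by apply: ler_wpM2l => //; rewrite subr_ge0.
have -> : c = s * (c * (1 + (1 - s) * y)) + (1 - s) * (c * (1 - s * y)) by ring.
lra.
Qed.

(** With [s] the step, [1 + v <= expR v] at [v = s * y] and at [v = - (s * y)] squeezes the quotient
    between [y] and [y / (1 - s * y)]. *)
Lemma expR_quotient_cvg (R : realType) (y : R) :
  (expR (n.+1%:R^-1 * y) - 1) / n.+1%:R^-1 @[n --> \oo] --> y.
Proof.
have sc : (n.+1%:R^-1 : R) @[n --> \oo] --> (0 : R) by exact: cvg_harmonic.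
have syc : 1 - n.+1%:R^-1 * y @[n --> \oo] --> (1 : R).
  rewrite -[X in _ --> X]subr0; apply: cvgB; first exact: cvg_cst.
  by rewrite -(mul0r y); apply: cvgM => //; exact: cvg_cst.
apply: (@squeeze_cvgr _ _ _ _ (cst y) (fun n => y / (1 - n.+1%:R^-1 * y))).
- near=> n.
  have s0 : 0 < n.+1%:R^-1 :> R by rewrite invr_gt0.
  have lt1 : 0 < 1 - n.+1%:R^-1 * y.
    by near: n; exact: (cvgr_gt _ syc 0 ltr01).
  set s : R := n.+1%:R^-1 in s0 lt1 *.
  apply/andP; split => /=.
    by rewrite ler_pdivlMr // mulrC lerBrDl expR_ge1Dx.
  rewrite ler_pdivrMr //.
  have : expR (s * y) * (1 - s * y) <= 1.
    rewrite -[leRHS](expRxMexpNx_1 (s * y)).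
    by rewrite ler_wpM2l ?expR_ge0 ?expR_ge1Dx.
  rewrite -ler_pdivlMr // => h.
  have -> : y / (1 - s * y) * s = 1 / (1 - s * y) - 1.
    by field; rewrite gt_eqF.
  by rewrite lerB.
- exact: cvg_cst.
- rewrite -[X in _ --> X]mulr1 -[in X in _ --> X]invr1.
  apply: cvgM; first exact: cvg_cst.
  by apply: cvgV => //; rewrite oner_neq0.
Unshelve. all: by end_near. Qed.

(** Dominated convergence along the steps [1 / (n + 1)]. The exponential moment at [1] controls the
    positive part of [Y], and a small moment at [- b] controls the negative part. *)
Lemma mgf_slope (R : realType) (d : measure_display) (T : measurableType d)
  (mu : {measure set T -> \bar R}) (D : set T) (f Y : T -> R) (b : R) :
  measurable D -> measurable_fun D f -> measurable_fun D Y ->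
  (forall x, D x -> 0 <= f x) -> 0 < b <= 1 ->
  (\int[mu]_(x in D) (f x)%:E = 1)%E ->
  (\int[mu]_(x in D) (f x * expR (Y x))%:E < +oo)%E ->
  (\int[mu]_(x in D) (f x * expR (- b * Y x))%:E < +oo)%E ->
  mu.-integrable D (fun x => (f x * Y x)%:E) /\
  forall e, 0 < e -> exists s, [/\ 0 < s, s <= 1 &
    fine (\int[mu]_(x in D) (f x * expR (s * Y x))%:E)%E - 1 <=
    s * (fine (\int[mu]_(x in D) (f x * Y x)%:E)%E + e)].
Proof.
move=> mD mf mY f0 /andP[b0 b1] f1 fY fbY.
have mexp (c : R) : measurable_fun D (fun x => f x * expR (c * Y x)).
  apply: measurable_funM => //; apply: measurableT_comp => //.
  exact: measurable_funM.
have if1 : mu.-integrable D (fun x => (f x)%:E).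
  apply/integrableP; split; first exact/measurable_EFinP.
  rewrite (eq_integral (fun x => (f x)%:E)) ?f1 ?ltry // => x.
  by rewrite inE => Dx; rewrite abse_EFin ger0_norm ?f0.
have iexp c : (\int[mu]_(x in D) (f x * expR (c * Y x))%:E < +oo)%E ->
    mu.-integrable D (fun x => (f x * expR (c * Y x))%:E).
  move=> h; apply/integrableP; split; first exact/measurable_EFinP.
  apply: le_lt_trans h; rewrite le_eqVlt; apply/orP; left; apply/eqP.
  apply: eq_integral => x; rewrite inE => Dx.
  by rewrite abse_EFin ger0_norm // mulr_ge0 ?f0 ?expR_ge0.
have ie1 : mu.-integrable D (fun x => (f x * expR (1 * Y x))%:E).
  by apply: iexp; under eq_integral do rewrite mul1r.
have ieb := iexp _ fbY.
(* The dominating function is [f] times (a bound on [|Y|], plus [1 + expR Y]); the bounds [Yb] and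
   [qb] below justify it. *)
pose g x := b^-1 * (f x * expR (- b * Y x)) + b^-1 * (f x * expR (1 * Y x)) +
            f x + f x * expR (1 * Y x).
have ig : mu.-integrable D (fun x => (g x)%:E).
  rewrite (_ : (fun x => _) = (fun x =>
     b^-1%:E * (f x * expR (- b * Y x))%:E + b^-1%:E * (f x * expR (1 * Y x))%:E +
     (f x)%:E + (f x * expR (1 * Y x))%:E)%E) //.
  by do 3! (apply: integrableD => //); apply: integrableZl.
pose s n : R := n.+1%:R^-1.
have s0 n : 0 < s n by rewrite invr_gt0.
have s1 n : s n <= 1 by rewrite invf_le1 ?ltr0n // ler1n.
pose fn n x := (f x * ((expR (s n * Y x) - 1) / s n))%:E.
have Yb x : `|Y x| <= b^-1 * expR (- b * Y x) + b^-1 * expR (1 * Y x).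
  rewrite mul1r -mulrDr ler_pdivlMl //.
  have [y0|y0] := leP 0 (Y x).
    rewrite ger0_norm //.
    have := expR_ge1Dx (Y x); have := expR_ge0 (- b * Y x).
    have : b * Y x <= 1 * Y x by exact: ler_wpM2r.
    lra.
  rewrite ltr0_norm //.
  have := expR_ge1Dx (- b * Y x); have := expR_ge0 (Y x); lra.
have qb n x : `|(expR (s n * Y x) - 1) / s n| <=
    `|Y x| + 1 + expR (1 * Y x).
  rewrite mul1r normrM [X in _ * X]gtr0_norm ?invr_gt0 // ler_pdivrMr //.
  have e1 := expR_ge1Dx (s n * Y x).
  have e2 : expR (s n * Y x) <= 1 - s n + s n * expR (Y x).
    by apply: expR_chord; rewrite s1 ltW.
  have := ler_norm (Y x); have := ler_norm (- Y x); rewrite normrN => h1 h2.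
  have k1 : s n * - Y x <= s n * `|Y x| by rewrite ler_pM2l.
  have k2 : 0 <= s n * expR (Y x) by rewrite mulr_ge0 ?expR_ge0 ?ltW.
  have k3 : 0 <= s n * `|Y x| by rewrite mulr_ge0 // ltW.
  have k4 := s0 n.
  rewrite ler_norml; apply/andP; split; lra.
have [] := @dominated_convergence _ _ _ mu D mD fn
   (fun x => (f x * Y x)%:E) (fun x => (g x)%:E).
- move=> n; apply/measurable_EFinP; apply: measurable_funM => //.
  apply: measurable_funM => //; apply: measurable_funB => //.
  by apply: measurableT_comp => //; exact: measurable_funM.
- by apply/measurable_EFinP; exact: measurable_funM.
- apply: aeW => x Dx; rewrite /fn; apply: cvg_EFin; first exact: nearW.
  apply: cvgM; first exact: cvg_cst.
  exact: expR_quotient_cvg.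
- exact: ig.
- apply: aeW => x n Dx; rewrite /fn abse_EFin lee_fin normrM ger0_norm ?f0 //.
  have -> : g x = f x * (b^-1 * expR (- b * Y x) + b^-1 * expR (1 * Y x) + 1
      + expR (1 * Y x)) by rewrite /g; ring.
  rewrite ler_wpM2l ?f0 //; apply: le_trans (qb n x) _.
  by rewrite !lerD.
move=> iY _ cY; split=> // e e0.
have fY' : (\int[mu]_(x in D) (f x * Y x)%:E)%E \is a fin_num.
  exact: integrable_fin_num.
move: cY; rewrite -(fineK fY').
set m := fine _ => cY.
have [n Hn] : exists n, (\int[mu]_(x in D) fn n x <= (m + e)%:E)%E.
  move/fine_cvgP : cY => [cfin cv].
  have clt := cvgr_lt _ cv (m + e) ltac:(by rewrite ltrDl).
  have [n [n1 n2]] := @filter_ex _ _ _ _ (filterI cfin (clt _)).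
  by exists n; rewrite -[leLHS](fineK n1) lee_fin ltW.
exists (s n); split=> //.
have is_ : mu.-integrable D (fun x => (f x * expR (s n * Y x))%:E).
  have i2 := integrableD mD if1 ie1.
  apply: (le_integrable mD _ _ i2); first exact/measurable_EFinP.
  move=> x Dx; rewrite /= lee_fin.
  rewrite !ger0_norm ?addr_ge0 ?mulr_ge0 ?f0 ?expR_ge0 //.
  rewrite -{2}[f x]mulr1 -mulrDr ler_wpM2l ?f0 // mul1r.
  have := @expR_chord _ (s n) (Y x); rewrite (ltW (s0 n)) s1 => /(_ isT).
  have : s n * expR (Y x) <= 1 * expR (Y x) by rewrite ler_wpM2r ?expR_ge0.
  have := s0 n; lra.
have is_fin := integrable_fin_num mD is_.
set v := fine _.
have vE : (\int[mu]_(x in D) fn n x = ((v - 1) / s n)%:E)%E.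
  transitivity (\int[mu]_(x in D) ((s n)^-1%:E * ((f x * expR (s n * Y x))%:E - (f x)%:E)))%E.
    apply: eq_integral => x _; rewrite /fn -EFinB -EFinM; congr EFin; ring.
  rewrite integralZl //; last exact: integrableB.
  rewrite integralB // f1 -(fineK is_fin) -/v -EFinB -EFinM mulrC //.
move: Hn; rewrite vE lee_fin ler_pdivrMr // mulrC => Hn.
exact: Hn.
Qed.

(** * Exponential rates and compactness *)

Lemma limn_esup_nlog_le (R : realType) (a : nat -> \bar R) (L C : R) :
  (forall n, 0 <= a n)%E ->
  (\forall n \near \oo, (a n <= (C * expR (- (n%:R * L)))%:E)%E) ->
  (limn_esup (fun n => nlog n (a n)) <= (- L)%:E)%E.
Proof.
move=> a0 aC; apply/lee_addgt0Pr => e e0.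
apply: ge_ereal_inf.
(* On this set of large indices the prefactor [C] costs at most [e] after division by [n]. *)
pose V := [set n : nat | (a n <= (C * expR (- (n%:R * L)))%:E)%E /\
  (0 < n)%N /\ ln C <= e * n%:R].
exists (ereal_sup ((fun n => nlog n (a n)) @` V)).
  exists V => //; rewrite /V; near=> n; split; first by near: n.
  split; first by near: n; exact: nbhs_infty_gt.
  rewrite -ler_pdivrMl // mulrC; near: n; exact: nbhs_infty_ger.
apply: ge_ereal_sup => _ [n [an [n0 Cn]] <-].
rewrite /nlog; case: eqP => [_|/eqP an0]; first by rewrite leNye.
have afin : a n \is a fin_num.
  by rewrite ge0_fin_numE //; apply: le_lt_trans an _; rewrite ltry.
have fpos : 0 < fine (a n) by rewrite fine_gt0 // lt0e an0 a0 /= ltey_eq afin.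
move: an; rewrite -(fineK afin) lee_fin => an.
have C0 : 0 < C.
  rewrite ltNge; apply/negP => C0.
  have : C * expR (- (n%:R * L)) <= 0 by rewrite mulr_le0_ge0 ?expR_ge0.
  by move=> /(le_trans an); rewrite leNgt fpos.
rewrite -EFinD lee_fin ler_pdivrMl ?ltr0n //.
have : ln (fine (a n)) <= ln (C * expR (- (n%:R * L))).
  by rewrite ler_ln ?posrE // mulr_gt0 ?expR_gt0.
rewrite lnM ?posrE ?expR_gt0 // expRK; lra.
Unshelve. all: by end_near. Qed.

(** Compactness as an induction principle. The sets [B] with [Q (A \ B)] form a filter; were it
    proper, the local hypothesis at a cluster point would give a member of the filter missing a
    neighbourhood of that point. *)
Lemma compact_finite_union_ind (T : topologicalType) (A : set T)
    (Q : set T -> Prop) :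
  compact A -> Q set0 -> (forall U V, Q U -> Q V -> Q (U `|` V)) ->
  (forall U V, U `<=` V -> Q V -> Q U) ->
  (forall x, A x -> exists2 U, nbhs x U & Q U) -> Q A.
Proof.
move=> cA Q0 QU QS Qloc.
pose F := [set B | Q (A `\` B)].
have FF : Filter F.
  split.
  - by rewrite /F /= setDT.
  - move=> B B' FB FB'; rewrite /F /= setDIr; exact: QU.
  - by move=> B B' BB'; apply: QS => x [Ax nB']; split => // /BB'.
have [F0|nF0] := pselect (F set0); first by move: F0; rewrite /F /= setD0.
have [|x [Ax xF]] := cA F (Build_ProperFilter nF0 FF).
  by rewrite /F /= setDv.
have [U xU QxU] := Qloc x Ax.
have FU : F (~` U) by rewrite /F /= setDE setCK; apply: QS QxU => y [].
by have [y []] := xF _ _ FU xU.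
Qed.

(** * Linear statistics of the sample *)

Lemma ler_coord_norm (R : realType) (n : nat) (v : 'rV[R]_n) (i : 'I_n) :
  `|v ord0 i| <= `|v|.
Proof.
rewrite -[leRHS]/(mx_norm v) mx_normrE.
exact: (@le_bigmax _ _ _ 0 (fun ij => `|v ij.1 ij.2|) (ord0, i)).
Qed.

Lemma ler_norm_dotr (R : realType) (n : nat) (v y : 'rV[R]_n) :
  `|dotr v y| <= `|v| * \sum_(i < n) `|y ord0 i|.
Proof.
apply: le_trans (ler_norm_sum _ _ _) _; rewrite mulr_sumr ler_sum // => i _.
by rewrite normrM ler_wpM2r // ler_coord_norm.
Qed.

Lemma dotrDl (R : realType) (n : nat) (x y z : 'rV[R]_n) :
  dotr (x + y) z = dotr x z + dotr y z.
Proof. by rewrite -big_split; apply: eq_bigr => i _ /=; rewrite mxE mulrDl. Qed.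

Lemma dotrZl (R : realType) (n : nat) (a : R) (x z : 'rV[R]_n) :
  dotr (a *: x) z = a * dotr x z.
Proof. by rewrite mulr_sumr; apply: eq_bigr => i _ /=; rewrite mxE mulrA. Qed.

Lemma dotrBl (R : realType) (n : nat) (x y z : 'rV[R]_n) :
  dotr (x - y) z = dotr x z - dotr y z.
Proof. by rewrite dotrDl -scaleN1r dotrZl mulN1r. Qed.

Lemma dotr_sumr (R : realType) (n m : nat) (x : 'rV[R]_n) (y : 'I_m -> 'rV[R]_n) :
  dotr x (\sum_i y i) = \sum_i dotr x (y i).
Proof.
rewrite /dotr exchange_big /=; apply: eq_bigr => j _.
by rewrite summxE mulr_sumr.
Qed.

Lemma dotr_deltal (R : realType) (n : nat) (i : 'I_n) (y : 'rV[R]_n) :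
  dotr (delta_mx ord0 i) y = y ord0 i.
Proof.
rewrite /dotr (bigD1 i) //= mxE !eqxx mul1r big1 ?addr0 // => j ji.
by rewrite mxE (negbTE ji) mul0r.
Qed.

Lemma open_segment (R : realType) (n : nat) (N : set 'rV[R]_n) (x v : 'rV[R]_n) :
  open N -> N x -> exists2 b : R, 0 < b <= 1 & N (x + b *: v).
Proof.
rewrite openE => oN /oN /nbhs_ballP[e /= e0 xN].
have v1 : 0 < `|v| + 1 by rewrite ltr_wpDl.
(* Adding one to the norm avoids division by zero and makes the final inequality strict. *)
pose b := Num.min 1 (e / (`|v| + 1)).
have b0 : 0 < b by rewrite lt_min ltr01 divr_gt0.
exists b; first by rewrite b0 ge_min lexx.
apply: xN; rewrite -ball_normE /= opprD addNKr normrN normrZ gtr0_norm //.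
apply: (@lt_le_trans _ _ (b * (`|v| + 1))); first by rewrite ltr_pM2l // ltrDl.
by rewrite -ler_pdivlMr // ge_min lexx orbT.
Qed.

Lemma measurable_dotr (R : realType) (d : measure_display) (T : measurableType d)
  (D : set T) (n : nat) (x : 'rV[R]_n) (t : T -> 'rV[R]_n) :
  (forall i, measurable_fun D (fun z => t z ord0 i)) ->
  measurable_fun D (fun z => dotr x (t z)).
Proof.
by move=> mt; apply: measurable_sum => i; apply: measurable_funM.
Qed.

Lemma integral_of_dlaw (R : realType) (q : nat) (Zs : set (q.-tuple R))
  (mu : {measure set (q.-tuple R) -> \bar R}) (f : q.-tuple R -> R)
  (dO : measure_display) (Omega : measurableType dO) (P : probability Omega R)
  (Z : Omega -> q.-tuple R) (g : q.-tuple R -> R) :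
  measurable Zs -> measurable_fun Zs f -> (forall z, Zs z -> 0 <= f z) ->
  measurable_fun setT Z ->
  (forall A, measurable A -> P (Z @^-1` A) = dlaw Zs mu f A) ->
  measurable_fun setT g -> (forall z, 0 <= g z) ->
  (\int[P]_w (g (Z w))%:E = \int[mu]_(z in Zs) (f z * g z)%:E)%E.
Proof.
move=> mZs mf f0 mZ law mg g0.
have := @ge0_integral_indic_transfer R _ _ _ Omega (q.-tuple R) (q.-tuple R)
  P mu setT Zs (cst 1) f Z id.
move=> /(_ measurableT mZs _ mf _ f0 mZ _ _ g mg g0) H.
under eq_integral do rewrite -[g _]mul1r.
apply: H => //.
move=> A mA; under eq_integral do rewrite mul1r.
rewrite [LHS](_ : _ = \int[P]_w (\1_(Z @^-1` A) w)%:E)%E //.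
have mZA : measurable (Z @^-1` A) by rewrite -[X in measurable X]setTI; exact: mZ.
rewrite integral_indic // setIT [LHS]law // /dlaw setIC integral_mkcondr.
apply: eq_integral => z _; rewrite patchE indicE.
by case: (z \in A); rewrite ?mulr1 ?mulr0.
Qed.

Lemma chernoff_linear (R : realType) (q k : nat) (Zs : set (q.-tuple R))
  (mu : {measure set (q.-tuple R) -> \bar R}) (f : q.-tuple R -> R)
  (dO : measure_display) (Omega : measurableType dO) (P : probability Omega R)
  (Z : nat -> Omega -> q.-tuple R) (t : q.-tuple R -> 'rV[R]_k)
  (v : 'rV[R]_k) (m a : R) (n : nat) :
  measurable Zs -> measurable_fun Zs f -> (forall z, Zs z -> 0 <= f z) ->
  (forall i, measurable_fun setT (Z i)) -> (forall i w, Zs (Z i w)) ->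
  (forall i A, measurable A -> P (Z i @^-1` A) = dlaw Zs mu f A) ->
  (forall A : nat -> set (q.-tuple R), (forall i, measurable (A i)) ->
     P (\bigcap_(i < n) Z i @^-1` A i) =
     (\prod_(i < n) fine (P (Z i @^-1` A i)))%:E) ->
  (forall i, measurable_fun Zs (fun z => t z ord0 i)) ->
  (\int[mu]_(z in Zs) (f z * expR (dotr v (t z)))%:E = m%:E)%E ->
  let B := [set w | n%:R * a <= dotr v (\sum_(i < n) t (Z i w))] in
  measurable B /\ (P B <= ((expR (- a) * m) ^+ n)%:E)%E.
Proof.
move=> mZs mf f0 mZ ZZs law indep mt fm B.
(* [t] is measurable only on [Zs]; extension by zero is harmless because the sample stays in
   [Zs]. *)
pose g := (fun z => dotr v (t z)) \_ Zs.
have mg : measurable_fun setT g.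
  have mvt : measurable_fun Zs (fun z => dotr v (t z)) by exact: measurable_dotr.
  exact: (measurable_restrictT _ mZs).1 mvt.
have gZ i w : g (Z i w) = dotr v (t (Z i w)) by rewrite /g patchE mem_set.
have -> : B = [set w | n%:R * a <= \sum_(i < n) g (Z i w)].
  by apply/seteqP; split => w; rewrite /B /= dotr_sumr;
    under eq_bigr do rewrite gZ.
split; first exact: (measurable_sum_ge n (n%:R * a) mZ mg).
apply: chernoff_iid => // i.
rewrite (@integral_of_dlaw _ _ Zs mu f _ _ P (Z i) (fun z => expR (g z))) //.
- rewrite -fm; apply: eq_integral => z zZs.
  by rewrite /g patchE zZs.
- exact: law.
- exact: measurableT_comp.
Qed.

(** * Exponential families and relative entropy *)

(** The log-normalizer is left abstract: that the density integrates to one is assumed point by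
    point, as it is available only on the parameter set. *)
Definition efam {R : realType} {T : Type} {k : nat} (h : T -> R)
  (t : T -> 'rV[R]_k) (phi : 'rV[R]_k -> R) (x : 'rV[R]_k) (z : T) : R :=
  h z * expR (dotr x (t z) - phi x).

Lemma measurable_efam (R : realType) (d : measure_display) (T : measurableType d)
  (D : set T) (k : nat) (h : T -> R) (t : T -> 'rV[R]_k) (phi : 'rV[R]_k -> R)
  (x : 'rV[R]_k) :
  measurable_fun D h -> (forall i, measurable_fun D (fun z => t z ord0 i)) ->
  measurable_fun D (efam h t phi x).
Proof.
move=> mh mt; apply: measurable_funM => //; apply: measurableT_comp => //.
by apply: measurable_funB => //; exact: measurable_dotr.
Qed.

(** Tilting by [y] moves the natural parameter from [x] to [x + y]. The free constant [c] covers
    both uses: [c = 0] leaves the raw Laplace integral, for points outside the parameter set, and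
    [c = phi (x + y)] gives a normalized density. *)
Lemma integral_efam_tilt (R : realType) (d : measure_display)
  (T : measurableType d) (mu : {measure set T -> \bar R})
  (D : set T) (k : nat) (h : T -> R) (t : T -> 'rV[R]_k)
  (phi : 'rV[R]_k -> R) (x y : 'rV[R]_k) (c : R) :
  measurable D -> measurable_fun D h -> (forall z, D z -> 0 <= h z) ->
  (forall i, measurable_fun D (fun z => t z ord0 i)) ->
  (\int[mu]_(z in D) (efam h t phi x z * expR (dotr y (t z)))%:E =
   (expR (c - phi x))%:E *
   \int[mu]_(z in D) (h z * expR (dotr (x + y) (t z) - c))%:E)%E.
Proof.
move=> mD mh h0 mt.
rewrite -ge0_integralZl_EFin ?expR_ge0 //.
- apply: eq_integral => z _; rewrite -EFinM; congr EFin.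
  by rewrite /efam -mulrA -expRD mulrCA -expRD dotrDl; congr (_ * expR _); ring.
- by move=> z Dz; rewrite lee_fin mulr_ge0 ?h0 ?expR_ge0.
- apply/measurable_EFinP; exact: (measurable_efam (fun=> c)).
Qed.

Lemma integral_efam_shift (R : realType) (d : measure_display)
  (T : measurableType d) (mu : {measure set T -> \bar R})
  (D : set T) (k : nat) (h : T -> R) (t : T -> 'rV[R]_k)
  (phi : 'rV[R]_k -> R) (x y : 'rV[R]_k) :
  measurable D -> measurable_fun D h -> (forall z, D z -> 0 <= h z) ->
  (forall i, measurable_fun D (fun z => t z ord0 i)) ->
  (\int[mu]_(z in D) (efam h t phi (x + y) z)%:E = 1)%E ->
  (\int[mu]_(z in D) (efam h t phi x z * expR (dotr y (t z)))%:E =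
   (expR (phi (x + y) - phi x))%:E)%E.
Proof.
move=> mD mh h0 mt e1.
by rewrite (integral_efam_tilt _ _ _ _ (phi (x + y))) // e1 mule1.
Qed.

(* The integral of [(xs - x).t] against the density at [x] is the derivative of
   [phi] at [x] in the direction [xs - x], and [1 + v <= expR v] turns the estimate
   of [mgf_slope] into one for the difference quotient of [phi]. *)
Lemma relent_efam_slope (R : realType) (q k : nat) (Zs : set (q.-tuple R))
  (mu : {measure set (q.-tuple R) -> \bar R}) (pstar f h : q.-tuple R -> R)
  (t : q.-tuple R -> 'rV[R]_k) (phi : 'rV[R]_k -> R) (x xs : 'rV[R]_k) (L : R) :
  measurable Zs -> measurable_fun Zs h -> (forall z, Zs z -> 0 <= h z) ->
  (forall i, measurable_fun Zs (fun z => t z ord0 i)) ->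
  is_density Zs mu pstar ->
  (forall A, measurable A -> dlaw Zs mu (efam h t phi xs) A = dlaw Zs mu pstar A) ->
  (forall s : R, (0 <= s <= 1)%R ->
    \int[mu]_(z in Zs) (efam h t phi (x + s *: (xs - x)) z)%:E = 1)%E ->
  open [set y : 'rV[R]_k |
    (\int[mu]_(z in Zs) (h z * expR (dotr y (t z)))%:E < +oo)%E] ->
  (\int[mu]_(z in Zs) (h z * expR (dotr x (t z)))%:E < +oo)%E ->
  (forall z, Zs z -> f z = efam h t phi x z) ->
  (relent Zs mu f pstar < +oo)%E -> (L%:E < relent Zs mu f pstar)%E ->
  exists s, [/\ 0 < s, s <= 1 &
    L < (phi x - phi (x + s *: (xs - x))) / s - phi x + phi xs].
Proof.
move=> mZs mh h0 mt [mp p0 p1] law seg oN Nx fE.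
rewrite /relent; case: ifP => // _ _.
have e1 : (\int[mu]_(z in Zs) (efam h t phi x z)%:E = 1)%E.
  by have := seg 0; rewrite lexx ler01 scale0r addr0; exact.
have es1 : (\int[mu]_(z in Zs) (efam h t phi xs z)%:E = 1)%E.
  by have := seg 1; rewrite lexx ler01 scale1r addrC subrK; exact.
have me y : measurable_fun Zs (efam h t phi y) by exact: measurable_efam.
have e0 y z : Zs z -> 0 <= efam h t phi y z.
  by move=> Zz; rewrite mulr_ge0 ?h0 ?expR_ge0.
pose Y z := dotr (xs - x) (t z).
have mY : measurable_fun Zs Y by exact: measurable_dotr.
(* Openness of the natural domain allows a short move from [x] away from [xs]; this supplies the
   negative exponential moment of [Y]. *)
have [b b01 Nb] := open_segment (x - xs) oN Nx.
have [iY slope] : mu.-integrable Zs (fun z => (efam h t phi x z * Y z)%:E) /\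
  forall e, 0 < e -> exists s, [/\ 0 < s, s <= 1 &
    fine (\int[mu]_(z in Zs) (efam h t phi x z * expR (s * Y z))%:E)%E - 1 <=
    s * (fine (\int[mu]_(z in Zs) (efam h t phi x z * Y z)%:E)%E + e)].
  apply: (@mgf_slope _ _ _ mu Zs (efam h t phi x) Y b mZs (me x) mY (e0 x) b01 e1).
    rewrite integral_efam_shift ?ltry //.
    by rewrite addrC subrK.
  rewrite (eq_integral (fun z => (efam h t phi x z *
      expR (dotr (b *: (x - xs)) (t z)))%:E)); last first.
    move=> z _ /=; rewrite dotrZl /Y !dotrBl; congr (_ * expR _)%:E; ring.
  rewrite (integral_efam_tilt _ _ _ _ 0) //.
  under eq_integral do rewrite subr0.
  move: Nb => /=; set I := (\int[mu]_(z in Zs) _)%E => Nb.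
  have If : I \is a fin_num.
    rewrite ge0_fin_numE // integral_ge0 // => z Zz.
    by rewrite lee_fin mulr_ge0 ?h0 ?expR_ge0.
  by rewrite -(fineK If) -EFinM ltry.
have ie y : (\int[mu]_(z in Zs) (efam h t phi y z)%:E = 1)%E ->
    mu.-integrable Zs (fun z => (efam h t phi y z)%:E).
  move=> ey; apply/integrableP; split; first exact/measurable_EFinP.
  rewrite (eq_integral (fun z => (efam h t phi y z)%:E)) ?ey ?ltry // => z.
  by rewrite inE => Zz; rewrite abse_EFin ger0_norm ?e0.
(* The relative entropy is written with the density [pstar], so equality of laws must first be
   turned into equality of densities almost everywhere. *)
have pae : ae_eq mu Zs (fun z => (efam h t phi xs z)%:E) (fun z => (pstar z)%:E).
  apply: integral_ae_eq => //; [exact: ie | exact/measurable_EFinP |].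
  by move=> E EZs mE; have := law E mE; rewrite /dlaw !setIidl.
have iYfin := integrable_fin_num mZs iY.
set D := fine _ in slope *.
have -> : (\int[mu]_(z in Zs) (f z * ln (f z / pstar z))%:E =
    (- D - phi x + phi xs)%:E)%E.
  transitivity (\int[mu]_(z in Zs) ((- phi x + phi xs)%:E * (efam h t phi x z)%:E -
     (efam h t phi x z * Y z)%:E))%E; last first.
    rewrite integralB //; last exact/integrableZl/ie.
    rewrite integralZl //; last exact: ie.
    rewrite e1 mule1 -(fineK iYfin) -/D -EFinB; congr EFin; ring.
  apply: ae_eq_integral => //.
  - have mf : measurable_fun Zs f.
      by apply: (eq_measurable_fun _ _ (me x)) => z; rewrite inE => /fE.
    apply/measurable_EFinP; apply: measurable_funM => //.
    apply: measurableT_comp => //; apply: measurable_funM => //.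
    apply: (eq_measurable_fun (fun z => pstar z `^ (-1))).
      by move=> z; rewrite inE => Zz; rewrite powR_inv1 ?p0.
    exact: (measurableT_comp (measurable_powR _) mp).
  - apply: emeasurable_funB.
      by apply/measurable_EFinP; apply: measurable_funM.
    by apply/measurable_EFinP; apply: measurable_funM.
  apply: filterS pae => z /= pz Zz; have [<-] := pz Zz.
  rewrite -EFinM -EFinB fE //; congr EFin.
  have [hz|hz] := eqVneq (h z) 0; first by rewrite /efam hz !mul0r mulr0 subrr.
  have -> : efam h t phi x z / efam h t phi xs z =
      expR (- Y z - phi x + phi xs).
    rewrite /efam invfM mulrACA divff // mul1r -expRN -expRD; congr expR.
    by rewrite /Y dotrBl; ring.
  by rewrite expRK; ring.
rewrite lte_fin => Lr.
(* Half of the gap between the relative entropy and [L], so that the final inequality stays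
   strict. *)
have [|s [s0 s1 ss]] := slope ((- D - phi x + phi xs - L) / 2); first lra.
exists s; split => //.
move: ss; rewrite (eq_integral (fun z => (efam h t phi x z *
      expR (dotr (s *: (xs - x)) (t z)))%:E)); last first.
  by move=> z _ /=; rewrite dotrZl.
rewrite integral_efam_shift //=; last by apply: seg; rewrite s1 ltW.
set ps := phi (x + _) => ss.
have := expR_ge1Dx (ps - phi x) => ge1.
have k1 : ps - phi x <= s * (D + (- D - phi x + phi xs - L) / 2) by lra.
have k2 : - (D + (- D - phi x + phi xs - L) / 2) <= (phi x - ps) / s.
  rewrite ler_pdivlMr //; lra.
lra.
Qed.

(** * Deviation bounds for near-maximizers *)

Lemma measure_bigsetU_le (R : realType) (d : measure_display)
  (T : measurableType d) (P : {measure set T -> \bar R}) (I : Type) (s : seq I)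
  (F : I -> set T) (c : R) :
  (forall i, measurable (F i) /\ (P (F i) <= c%:E)%E) ->
  measurable (\big[setU/set0]_(i <- s) F i) /\
  (P (\big[setU/set0]_(i <- s) F i) <= ((size s)%:R * c)%:E)%E.
Proof.
move=> Fc; elim: s => [|i s [mB PB]]; first by rewrite big_nil measure0 mul0r.
rewrite big_cons /=; have [mi Pi] := Fc i; split; first exact: measurableU.
apply: le_trans (measureU2 _ mi mB) _.
rewrite -natr1 mulrDl mul1r addrC EFinD; exact: leeD.
Qed.

Section exponential_family_sample.
Context (R : realType) (q k : nat) (Zs : set (q.-tuple R))
  (mu : {measure set (q.-tuple R) -> \bar R}) (h : q.-tuple R -> R)
  (t : q.-tuple R -> 'rV[R]_k) (phi : 'rV[R]_k -> R) (xs : 'rV[R]_k)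
  (dO : measure_display) (Omega : measurableType dO) (P : probability Omega R)
  (Z : nat -> Omega -> q.-tuple R).
Context (mZs : measurable Zs) (mh : measurable_fun Zs h)
  (h0 : forall z, Zs z -> 0 <= h z)
  (mt : forall i, measurable_fun Zs (fun z => t z ord0 i))
  (mZ : forall i, measurable_fun setT (Z i)) (ZZs : forall i w, Zs (Z i w))
  (law : forall i A, measurable A ->
     P (Z i @^-1` A) = dlaw Zs mu (efam h t phi xs) A)
  (indep : forall n (A : nat -> set (q.-tuple R)), (forall i, measurable (A i)) ->
     P (\bigcap_(i < n) Z i @^-1` A i) =
     (\prod_(i < n) fine (P (Z i @^-1` A i)))%:E)
  (oN : open [set y : 'rV[R]_k |
    (\int[mu]_(z in Zs) (h z * expR (dotr y (t z)))%:E < +oo)%E])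
  (Nxs : (\int[mu]_(z in Zs) (h z * expR (dotr xs (t z)))%:E < +oo)%E).

Local Notation S n w := (\sum_(i < n) t (Z i w)).

Let mf : measurable_fun Zs (efam h t phi xs).
Proof. exact: measurable_efam. Qed.

Let f0 z : Zs z -> 0 <= efam h t phi xs z.
Proof. by move=> Zz; rewrite mulr_ge0 ?h0 ?expR_ge0. Qed.

Lemma direction_tight (v : 'rV[R]_k) (L : R) :
  exists2 a, 0 <= a & forall n,
    measurable [set w | n%:R * a <= dotr v (S n w)] /\
    (P [set w | (n%:R * a <= dotr v (S n w))%R] <= (expR (- (n%:R * L)))%:E)%E.
Proof.
have [b /andP[b0 _] Nb] := open_segment v oN Nxs.
have [m m0 mE] : exists2 m, 0 <= m & (\int[mu]_(z in Zs)
    (efam h t phi xs z * expR (dotr (b *: v) (t z)))%:E = m%:E)%E.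
  rewrite (integral_efam_tilt _ _ _ _ 0) //.
  under eq_integral do rewrite subr0.
  move: Nb => /=; set I := (\int[mu]_(z in Zs) _)%E => Nb.
  have I0 : (0 <= I)%E.
    by apply: integral_ge0 => z Zz; rewrite lee_fin mulr_ge0 ?h0 ?expR_ge0.
  have If : I \is a fin_num by rewrite ge0_fin_numE.
  exists (expR (0 - phi xs) * fine I); first by rewrite mulr_ge0 ?expR_ge0 ?fine_ge0.
  by rewrite EFinM fineK.
(* The tilt [b *: v] gives [m * expR (- (|L| + m))] per observation, which is at most [expR (- L)]
   because [m <= expR m]. *)
exists ((`|L| + m) / b); first by rewrite divr_ge0 ?addr_ge0 // ltW.
move=> n.
have := chernoff_linear (`|L| + m) mZs mf f0 mZ ZZs law (indep n) mt mE.
have -> : [set w | n%:R * ((`|L| + m) / b) <= dotr v (S n w)] =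
    [set w | n%:R * (`|L| + m) <= dotr (b *: v) (S n w)].
  apply/seteqP; split => w /=;
    by rewrite dotrZl mulrA ler_pdivrMr // [dotr v _ * b]mulrC.
move=> /= [mB PB]; split => //; apply: le_trans PB _.
rewrite lee_fin -mulrN expRM_natl; apply: lerXn2r.
- by rewrite nnegrE mulr_ge0 ?expR_ge0.
- by rewrite nnegrE expR_ge0.
rewrite opprD expRD -mulrA -[leRHS]mulr1 ler_pM ?expR_ge0 ?mulr_ge0 ?expR_ge0 //.
  by rewrite ler_expR lerN2 ler_norm.
have <- := expRxMexpNx_1 m.
rewrite mulrC ler_wpM2r ?expR_ge0 //.
have := expR_ge1Dx m; lra.
Qed.

Lemma sum_tight (L : R) :
  exists2 M, 0 <= M & forall n, exists B, [/\ measurable B,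
    (P B <= ((k * 2)%:R * expR (- (n%:R * L)))%:E)%E &
    forall w, ~ B w -> \sum_(j < k) `|(S n w) ord0 j| <= n%:R * M].
Proof.
(* The signed basis vectors: avoiding these [2 k] half-spaces bounds every coordinate of the sum in
   absolute value. *)
pose v (i : 'I_k * bool) : 'rV[R]_k := (-1) ^+ i.2 *: delta_mx ord0 i.1.
have /choice[a Ha] : forall i, exists a, 0 <= a /\ forall n,
    measurable [set w | n%:R * a <= dotr (v i) (S n w)] /\
    (P [set w | (n%:R * a <= dotr (v i) (S n w))%R] <= (expR (- (n%:R * L)))%:E)%E.
  by move=> i; have [a a0 Pa] := direction_tight (v i) L; exists a.
exists (\sum_(j < k) (a (j, false) + a (j, true))).
  by apply: sumr_ge0 => j _; rewrite addr_ge0 //; apply: (Ha _).1.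
move=> n.
pose F i := [set w | n%:R * a i <= dotr (v i) (S n w)].
have [mB PB] := @measure_bigsetU_le _ _ _ P _ (enum {: 'I_k * bool}) F _
   (fun i => (Ha i).2 n).
exists (\big[setU/set0]_(i <- enum {: 'I_k * bool}) F i); split => //.
  by move: PB; rewrite -cardE card_prod card_ord card_bool.
move=> w nB; rewrite mulr_sumr ler_sum // => j _.
have nF i : dotr (v i) (S n w) <= n%:R * a i.
  rewrite leNgt; apply/negP => /ltW Fi; apply: nB.
  rewrite -bigcup_seq; exists i => //=; exact: mem_enum.
have := nF (j, false); have := nF (j, true).
rewrite /v /= expr0 expr1 scale1r dotrZl dotr_deltal mulN1r => n1 n2.
have p1 : 0 <= n%:R * a (j, true) by rewrite mulr_ge0 //; case: (Ha (j, true)).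
have p2 : 0 <= n%:R * a (j, false) by rewrite mulr_ge0 //; case: (Ha (j, false)).
rewrite mulrDr ler_norml; apply/andP; split; lra.
Qed.

(** The event [B] is a half-space depending only on the centre [x], so one Chernoff bound serves all
    [x'] in the ball. With [kap] the gap in the rate, replacing [x'] by [x] in the linear term,
    replacing [phi x'] by [phi x], and the slack [c] each cost at most [n * kap * s / 3]. *)
Lemma near_maximizer_local_bound (M L s : R) (x : 'rV[R]_k) :
  0 <= M -> 0 < s -> (\int[mu]_(z in Zs) (efam h t phi x z)%:E = 1)%E ->
  L < (phi x - phi (x + s *: (xs - x))) / s - phi x + phi xs ->
  exists r e : R, [/\ 0 < r, 0 < e & forall n, exists B, [/\ measurable B,
    (P B <= (expR (- (n%:R * L)))%:E)%E & forall w x' c,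
    `|x' - x| < r -> `|phi x' - phi x| <= e -> c <= n%:R * e ->
    \sum_(j < k) `|(S n w) ord0 j| <= n%:R * M ->
    dotr (x + s *: (xs - x)) (S n w) - n%:R * phi (x + s *: (xs - x)) <=
      dotr x' (S n w) - n%:R * phi x' + c -> B w]].
Proof.
move=> M0 s0 x1; set y := x + s *: (xs - x) => rate.
pose kap := (phi x - phi y) / s - phi x + phi xs - L.
have kap0 : 0 < kap by rewrite subr_gt0.
exists (kap * s / 3 / (M + 1)), (kap * s / 3); split.
- by rewrite !divr_gt0 ?mulr_gt0 // ltr_wpDl.
- by rewrite divr_gt0 ?mulr_gt0.
(* The threshold for which the tilt [x - xs], of log-moment [phi x - phi xs], gives exactly the
   exponent [L]. *)
move=> n; set a := L + phi x - phi xs.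
have tilt : (\int[mu]_(z in Zs) (efam h t phi xs z *
    expR (dotr (x - xs) (t z)))%:E = (expR (phi x - phi xs))%:E)%E.
  have xE : xs + (x - xs) = x by rewrite addrC subrK.
  by rewrite integral_efam_shift // xE.
have [mB PB] := chernoff_linear a mZs mf f0 mZ ZZs law (indep n) mt tilt.
exists [set w | n%:R * a <= dotr (x - xs) (S n w)]; split => //.
  rewrite -mulrN expRM_natl; move: PB => /=.
  by rewrite -expRD (_ : - a + (phi x - phi xs) = - L) // /a; ring.
move=> w x' c xr phie ce SM mx /=.
have d1 : dotr x' (S n w) - dotr x (S n w) <= n%:R * (kap * s / 3).
  rewrite -dotrBl; apply: le_trans (ler_norm _) _.
  apply: le_trans (ler_norm_dotr _ _) _.
  apply: (@le_trans _ _ (kap * s / 3 / (M + 1) * (n%:R * M))).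
    by rewrite ler_pM ?sumr_ge0 // ltW.
  rewrite mulrCA ler_wpM2l // mulrAC ler_pdivrMr; last by rewrite ltr_wpDl.
  by rewrite ler_wpM2l ?lerDl // ltW // divr_gt0 ?mulr_gt0.
have d2 : n%:R * (phi x - phi x') <= n%:R * (kap * s / 3).
  rewrite ler_wpM2l //; apply: le_trans phie; rewrite distrC; exact: ler_norm.
have ys : dotr y (S n w) = dotr x (S n w) - s * dotr (x - xs) (S n w).
  by rewrite /y dotrDl dotrZl !dotrBl; ring.
rewrite -(ler_pM2l s0).
have sa : s * (n%:R * a) = n%:R * (phi x - phi y) - n%:R * (kap * s).
  rewrite /a /kap; field; exact: lt0r_neq0.
rewrite sa; move: mx; rewrite ys; lra.
Qed.

Lemma near_maximizer_bound (C C' : set 'rV[R]_k) (c : nat -> R) (L : R) :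
  compact C -> C' `<=` C -> Defs.convex_set C -> C xs ->
  (forall x, C x -> \int[mu]_(z in Zs) (efam h t phi x z)%:E = 1)%E ->
  (forall x, C x -> forall e, 0 < e -> exists2 r, 0 < r &
     forall x', C x' -> `|x' - x| < r -> `|phi x' - phi x| <= e) ->
  (forall x, C x -> closure C' x -> exists s, [/\ 0 < s, s <= 1 &
     L < (phi x - phi (x + s *: (xs - x))) / s - phi x + phi xs]) ->
  (forall e, 0 < e -> \forall n \near \oo, c n <= n%:R * e) ->
  exists N : R, \forall n \near \oo, exists B, [/\ measurable B,
    (P B <= (N * expR (- (n%:R * L)))%:E)%E & forall w x', C' x' ->
      (forall x, C x -> dotr x (S n w) - n%:R * phi x <=
         dotr x' (S n w) - n%:R * phi x' + c n) -> B w].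
Proof.
move=> cC C'C cvxC Cxs C1 phiC rate co.
have [M M0 tight] := sum_tight L.
(* The bound on the sum is a premise inside [Q]: [M] must be fixed before the radii are chosen, and
   the tightness event is added only once, after the cover. *)
pose Q U := exists N : R, \forall n \near \oo, exists B, [/\ measurable B,
    (P B <= (N * expR (- (n%:R * L)))%:E)%E & forall w x', C' x' -> U x' ->
      \sum_(j < k) `|(S n w) ord0 j| <= n%:R * M ->
      (forall x, C x -> dotr x (S n w) - n%:R * phi x <=
         dotr x' (S n w) - n%:R * phi x' + c n) -> B w].
have [N QC] : Q C.
  apply: compact_finite_union_ind => //.
  - exists 0; apply: nearW => n; exists set0; split => //.
    by rewrite measure0 mul0r.
  - move=> U V [N1 Q1] [N2 Q2]; exists (N1 + N2); near=> n.
    have [B1 [mB1 P1 H1]] : exists B, [/\ measurable B,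
      (P B <= (N1 * expR (- (n%:R * L)))%:E)%E & forall w x', C' x' -> U x' ->
      \sum_(j < k) `|(S n w) ord0 j| <= n%:R * M ->
      (forall x, C x -> dotr x (S n w) - n%:R * phi x <=
         dotr x' (S n w) - n%:R * phi x' + c n) -> B w] by near: n.
    have [B2 [mB2 P2 H2]] : exists B, [/\ measurable B,
      (P B <= (N2 * expR (- (n%:R * L)))%:E)%E & forall w x', C' x' -> V x' ->
      \sum_(j < k) `|(S n w) ord0 j| <= n%:R * M ->
      (forall x, C x -> dotr x (S n w) - n%:R * phi x <=
         dotr x' (S n w) - n%:R * phi x' + c n) -> B w] by near: n.
    exists (B1 `|` B2); split; first exact: measurableU.
      apply: le_trans (measureU2 _ mB1 mB2) _.
      rewrite mulrDl EFinD; exact: leeD.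
    by move=> w x' Cx' [Ux'|Vx'] Sw mx; [left; exact: H1 Sw mx|right; exact: H2 Sw mx].
  - move=> U V UV [N QV]; exists N; apply: filterS QV => n [B [mB PB HB]].
    by exists B; split => // w x' Cx' /UV Vx'; exact: HB.
  (* [C'] need not be closed. Off its closure some neighbourhood misses [C'] and the empty event
     suffices; on the closure the rate hypothesis applies. *)
  - move=> x Cx; have [clx|nclx] := pselect (closure C' x); last first.
      have /existsNP[U /not_implyP[xU nU]] := nclx.
      exists U => //; exists 0; apply: nearW => n; exists set0; split => //.
        by rewrite measure0 mul0r.
      by move=> w x' Cx' Ux'; exfalso; apply: nU; exists x'.
    have [s [s0 s1 Ls]] := rate x Cx clx.
    have [r [e [r0 e0 HB]]] := near_maximizer_local_bound M0 s0 (C1 x Cx) Ls.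
    have [r' r'0 phir] := phiC x Cx e e0.
    have rr : 0 < Num.min r r' by rewrite lt_min r0.
    exists (ball x (Num.min r r')); first exact: nbhsx_ballx.
    exists 1; apply: filterS (co e e0) => n cn.
    have [B [mB PB Bw]] := HB n; exists B; rewrite mul1r; split => //.
    move=> w x' Cx'; rewrite -ball_normE /= distrC lt_min => /andP[xr xr'] Sw mx.
    apply: (Bw w x' (c n)) => //; first by apply: phir => //; exact: C'C.
    apply: mx.
    rewrite (_ : x + _ = s *: xs + (1 - s) *: x).
      by apply: cvxC => //; rewrite s1 ltW.
    by rewrite scalerBr scalerBl scale1r addrCA.
exists (N + (k * 2)%:R); apply: filterS QC => n [B [mB PB HB]].
have [B' [mB' PB' HB']] := tight n.
exists (B `|` B'); split; first exact: measurableU.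
  apply: le_trans (measureU2 _ mB mB') _.
  rewrite mulrDl EFinD; exact: leeD.
move=> w x' Cx' mx; have [B'w|nB'w] := pselect (B' w); first by right.
by left; apply: (HB w x') => //; [exact: C'C|exact: HB'].
Unshelve. all: by end_near. Qed.

End exponential_family_sample.

(* [crd Kstar] and [crd Kstar.-1] may induce different topologies on
   [Theta Kstar.-1], which is only known to be compact for the latter; the closure
   of its image under the former nevertheless contains no new density. *)
Lemma closure_param_same_values (R : realType) (Th I : Type) (m m' : nat)
  (crd : Th -> 'rV[R]_m) (crd' : Th -> 'rV[R]_m') (A B : set Th) (D : set I)
  (g : Th -> I -> R) (th : Th) :
  A `<=` B -> compact (crd' @` A) ->
  (forall z, D z -> cont_on crd' A (g^~ z)) ->
  (forall z, D z -> cont_on crd B (g^~ z)) ->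
  B th -> closure (crd @` A) (crd th) ->
  exists2 th1, A th1 & forall z, D z -> g th1 z = g th z.
Proof.
move=> AB cA contA contB Bth clth.
(* Parameters of [A] close to [th] for [crd], viewed through [crd']: compactness there yields [th1],
   and continuity for both coordinates identifies the values. *)
pose U r := crd' @` [set a | A a /\ `|crd a - crd th| < r].
pose F := filter_from [set r : R | 0 < r] U.
have FF : ProperFilter F.
  apply: filter_from_proper.
    apply: filter_from_filter; first by exists 1 => /=.
    move=> r r' /= r0 r'0; exists (Num.min r r'); first by rewrite /= lt_min r0.
    move=> y [a [Aa]]; rewrite lt_min => /andP[ar ar'] <-{y}.
    by split; exists a.
  move=> r /= r0; have [_ [[a Aa <-]]] := clth _ (nbhsx_ballx (crd th) r r0).
  rewrite -ball_normE /= distrC => ar.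
  by exists (crd' a), a.
have FA : F (crd' @` A) by exists 1 => //= _ [a [Aa _] <-]; exists a.
have [_ [[th1 Ath1 <-] clF]] := cA F FF FA.
exists th1 => // z Dz; apply/eqP; rewrite -subr_eq0; apply/negPn/negP => ne.
pose e := `|g th1 z - g th z| / 2.
have e0 : 0 < e by rewrite divr_gt0 // normr_gt0.
have [r r0 Hr] := contB z Dz th Bth e e0.
have [r1 r10 Hr1] := contA z Dz th1 Ath1 e e0.
have [_ [[a [Aa ar] <-]]] := clF (U r) (ball (crd' th1) r1)
  ltac:(by exists r) (nbhsx_ballx (crd' th1) r1 r10).
rewrite -ball_normE /= distrC => ar1.
have g1 := Hr a (AB _ Aa) ar; have g2 := Hr1 a Aa ar1.
have : `|g th1 z - g th z| <= `|g a z - g th1 z| + `|g a z - g th z|.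
  rewrite (distrC (g a z)); exact: ler_distD.
move: g1 g2; rewrite /e; lra.
Qed.

(** * The underestimation event *)

Lemma measurable_Khat_lt (R : realType) (T Th : Type) (dO : measure_display)
  (Omega : measurableType dO) (p : Th -> T -> R) (Theta : nat -> set Th)
  (pen : nat -> nat -> R) (Z : nat -> Omega -> T) (n Kstar : nat) :
  (forall K, measurable_fun setT
     (fun w => ereal_sup [set (loglik p n (fun i => Z i w) th)%:E | th in Theta K]
       : \bar R)) ->
  measurable (Khat_lt p Theta pen Z n Kstar).
Proof.
move=> msup.
pose cr K w := crit p Theta pen n K (fun i => Z i w).
have mcr K : measurable_fun setT (cr K) by exact: emeasurable_funB.
have -> : Khat_lt p Theta pen Z n Kstar = \bigcup_(K in [set K | (K < Kstar)%N])
    \bigcap_K' [set w | (cr K' w <= cr K w)%E].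
  apply/seteqP; split => w /=; first by move=> [K [KK H]]; exists K => // K' _; exact: H.
  by move=> [K KK H]; exists K; split => // K'; exact: H.
apply: bigcup_measurable => K _; apply: bigcap_measurableType => K' _.
rewrite -[X in measurable X]setTI; exact: measurable_lee.
Qed.

(** The added [1] pays for replacing the supremum over the selected model by a value at a point. The
    bound [U] excludes the value [+oo], and [th0] excludes [-oo], hence an empty selected model. *)
Lemma Khat_lt_near_maximizer (R : realType) (T Th Omega : Type)
  (p : Th -> T -> R) (Theta : nat -> set Th) (pen : nat -> nat -> R)
  (Z : nat -> Omega -> T) (n Kstar : nat) (w : Omega) (U : R) (th0 : Th) :
  (forall K, Theta K `<=` Theta K.+1) -> (forall K, 0 < pen n K) ->
  Theta Kstar th0 ->
  (forall K th, Theta K th -> loglik p n (fun i => Z i w) th <= U) ->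
  Khat_lt p Theta pen Z n Kstar w ->
  exists2 th', Theta Kstar.-1 th' & forall th, Theta Kstar th ->
    loglik p n (fun i => Z i w) th <=
    loglik p n (fun i => Z i w) th' + (pen n Kstar + 1).
Proof.
move=> nest penp th0K LU [K [KK /(_ Kstar)]].
have mono K1 K2 : (K1 <= K2)%N -> Theta K1 `<=` Theta K2.
  move=> /subnK <-; elim: (K2 - K1)%N => // i IH.
  by rewrite addSn; apply: subset_trans IH (nest _).
rewrite /crit; set LL := loglik p n (fun i => Z i w).
set Ss := ereal_sup _; set Sk := ereal_sup _ => SS.
have Ssge th : Theta Kstar th -> ((LL th)%:E <= Ss)%E.
  by move=> ?; apply: ereal_sup_ubound; exists th.
have SkU : (Sk <= U%:E)%E.
  by apply: ge_ereal_sup => _ [th /LU ? <-]; rewrite lee_fin.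
have leS th : Theta Kstar th -> ((LL th - pen n Kstar)%:E <= Sk - (pen n K)%:E)%E.
  by move=> ?; apply: le_trans SS; rewrite EFinB leeB // Ssge.
have Skfin : Sk \is a fin_num.
  rewrite fin_numE; apply/andP; split.
    apply/eqP => SkN; have := leS _ th0K.
    by rewrite SkN /=.
  by rewrite lt_eqF // (le_lt_trans SkU) // ltry.
have [_ [th' Kth' <-] Hth'] := ub_ereal_sup_adherent ltr01 Skfin.
exists th'; first by apply: mono Kth'; rewrite -ltnS (ltn_predK KK).
move=> th /leS; move: Hth'; rewrite -/Sk -(fineK Skfin) -!EFinB lte_fin lee_fin.
have := penp K; rewrite -/LL; lra.
Qed.

(* Inside [theorem9] the name [convex_set] denotes the library's notion, which
   shadows the one of [Defs]. *)
Lemma convex_set_Defs (R : realType) (m : nat) (A : set 'rV[R]_m) :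
  convex_set A -> Defs.convex_set A.
Proof.
move=> cA x y l Ax Ay /andP[l0 l1].
by have := cA x y (Itv01 l0 l1) (mem_set Ax) (mem_set Ay); rewrite inE.
Qed.

Theorem theorem9
  (R : realType) (q : nat) (Zs : set (q.-tuple R))
  (mu : {measure set (q.-tuple R) -> \bar R})
  (pstar : q.-tuple R -> R)
  (dO : measure_display) (Omega : measurableType dO) (P : probability Omega R)
  (Z : nat -> Omega -> q.-tuple R)
  (Th : Type) (Theta : nat -> set Th) (dim : nat -> nat)
  (crd : forall K : nat, Th -> 'rV[R]_(dim K))
  (p : Th -> q.-tuple R -> R) (pen : nat -> nat -> R)
  (l u : q.-tuple R -> R) (Kstar : nat)
  (h : q.-tuple R -> R) (t : q.-tuple R -> 'rV[R]_(dim Kstar))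
  (* the sample space: a Polish subset of R^q, mu = Lebesgue measure *)
  (HZs : polish_subset Zs) (HZm : measurable Zs) (Hmu : is_lebesgue mu)
  (* P^* has density pstar; Z_1, Z_2, ... i.i.d. with law P^* *)
  (Hpstar : is_density Zs mu pstar)
  (HZmeas : forall i, measurable_fun setT (Z i))
  (HZval : forall i w, Zs (Z i w))
  (Hlaw : forall i (A : set (q.-tuple R)), measurable A ->
     P (Z i @^-1` A) = dlaw Zs mu pstar A)
  (Hindep : forall n (A : nat -> set (q.-tuple R)), (forall i, measurable (A i)) ->
     P (\bigcap_(i < n) Z i @^-1` A i) = (\prod_(i < n) fine (P (Z i @^-1` A i)))%:E)
  (* nested parameter sets, Theta_0 = empty (Pi_0 = empty), densities p_theta *)
  (HTheta0 : Theta 0%N = set0)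
  (Hnest : forall K, Theta K `<=` Theta K.+1)
  (Hdens : forall th, (exists K, Theta K th) -> is_density Zs mu (p th))
  (* (A1) *)
  (HA1 : forall K, compact (crd K @` Theta K) /\
     (forall x y, Theta K x -> Theta K y -> crd K x = crd K y -> x = y))
  (* (A2) *)
  (HA2 : forall K z, Zs z -> cont_on (crd K) (Theta K) (fun th => ln (p th z)))
  (* (A3) *)
  (HA3lu : measurable_fun Zs l /\ measurable_fun Zs u /\ L1P Zs mu pstar (u \- l))
  (HA3star : forall z, Zs z -> l z <= ln (pstar z) <= u z)
  (HA3 : forall th z, (exists K, Theta K th) -> Zs z -> l z <= ln (p th z) <= u z)
  (* (A4) *)
  (HA4pos : forall n K, 0 < pen n K)
  (HA4mon : forall n K K', (K <= K')%N -> pen n K <= pen n K')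
  (HA4inf : forall K, (fun n => pen n K) @ \oo --> +oo)
  (HA4o : forall K, (fun n : nat => pen n K / n%:R) @ \oo --> 0)
  (* all suprema measurable *)
  (Hsupm : forall n K, measurable_fun setT
     (fun w => ereal_sup [set (loglik p n (fun i => Z i w) th)%:E | th in Theta K] : \bar R))
  (* P^* has order Kstar < oo *)
  (Horder : in_Pi Zs mu p (Theta Kstar) pstar /\ ~ in_Pi Zs mu p (Theta Kstar.-1) pstar)
  (* finite relative entropies, p_theta l_theta in L^1(mu) *)
  (HH : forall th, (exists K, Theta K th) ->
     (relent Zs mu (p th) pstar < +oo)%E /\
     mu.-integrable Zs (fun z => (p th z * ln (p th z))%:E))
  (* {l_theta} in L_tau(P^* ) *)
  (HLtau : forall th, (exists K, Theta K th) -> Ltau Zs mu pstar (fun z => ln (p th z)))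
  (* finite nets for Q l_theta, Q in calQ *)
  (Hnet : forall K (Q : (q.-tuple R -> R) -> R), in_calQ Zs mu pstar Q ->
     forall e : R, 0 < e -> exists (m : nat) (tt : nat -> Th),
       (forall i, (i < m)%N -> Theta K (tt i)) /\
       forall th, Theta K th -> exists i, (i < m)%N /\
         `|Q (fun z => ln (p th z)) - Q (fun z => ln (p (tt i) z))| <= e)
  (* u - l in M_tau(P^* ) *)
  (HMtau : Mtau Zs mu pstar (u \- l))
  (* differentiability with remainder F o(h), K <= Kstar *)
  (Hdiff : forall K, (K <= Kstar)%N -> forall th, Theta K th ->
     interior (crd K @` Theta K) (crd K th) ->
     exists dl : q.-tuple R -> 'rV[R]_(dim K),
       (forall i, Mtau Zs mu pstar (fun z => dl z ord0 i)) /\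
       exists (F : q.-tuple R -> R) (r : 'rV[R]_(dim K) -> R),
         [/\ Ltau Zs mu pstar F, is_o_at0 r &
           forall th' z, Theta K th' -> Zs z ->
             `|ln (p th' z) - ln (p th z) - dotr (dl z) (crd K th' - crd K th)|
               <= F z * r (crd K th' - crd K th)])
  (* Pi_Kstar is an exponential model *)
  (Hdim : dim Kstar = Kstar)
  (Hh : measurable_fun Zs h /\ (forall z, Zs z -> 0 <= h z))
  (Ht : forall i, measurable_fun Zs (fun z => t z ord0 i))
  (Hnat_open : open [set x : 'rV[R]_(dim Kstar) |
     (\int[mu]_(z in Zs) (h z * expR (dotr x (t z)))%:E < +oo)%E])
  (Hnat_sub : crd Kstar @` Theta Kstar `<=` [set x : 'rV[R]_(dim Kstar) |
     (\int[mu]_(z in Zs) (h z * expR (dotr x (t z)))%:E < +oo)%E])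
  (Hconvex : convex_set (crd Kstar @` Theta Kstar))
  (Hexp : forall th z, Theta Kstar th -> Zs z ->
     p th z = h z * expR (dotr (crd Kstar th) (t z)
       - ln (fine (\int[mu]_(y in Zs) (h y * expR (dotr (crd Kstar th) (t y)))%:E)%E))) :
  (limn_esup (fun n => nlog n (P (Khat_lt p Theta pen Z n Kstar)))
     <= - relent_set Zs mu p (Theta Kstar.-1) pstar)%E.
Proof.
set C := crd Kstar @` Theta Kstar.
have [mh h0] := Hh.
have cvxC := convex_set_Defs Hconvex.
have [phi pE] : exists phi, forall th z, Theta Kstar th -> Zs z ->
    p th z = efam h t phi (crd Kstar th) z.
  by exists (fun x => ln (fine (\int[mu]_(y in Zs) (h y * expR (dotr x (t y)))%:E)%E)).
have C1 x : C x -> (\int[mu]_(z in Zs) (efam h t phi x z)%:E = 1)%E.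
  move=> [th Kth <-]; have [_ _ <-] := Hdens th (ex_intro _ Kstar Kth).
  rewrite /dlaw setTI; apply: eq_integral => z; rewrite inE => Zz.
  by rewrite pE.
have [[ths Kths plaw] _] := Horder.
set xs := crd Kstar ths.
have Cxs : C xs by exists ths.
have elaw A : measurable A -> dlaw Zs mu (efam h t phi xs) A = dlaw Zs mu pstar A.
  move=> mA; rewrite -plaw //; apply: eq_integral => z; rewrite inE => -[_ Zz].
  by rewrite pE.
have law i A : measurable A ->
    P (Z i @^-1` A) = dlaw Zs mu (efam h t phi xs) A.
  by move=> mA; rewrite Hlaw // elaw.
(* A density integrating to one cannot have [h] zero throughout [Zs]. *)
have [z0 Zz0 hz0] : exists2 z0, Zs z0 & 0 < h z0.
  apply: contrapT => nz; have := C1 xs Cxs.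
  rewrite (eq_integral (cst 0%E)).
    by rewrite integral0 => /eqP; rewrite eq_sym onee_eq0.
  move=> z; rewrite inE => Zz; rewrite /efam.
  have [hz|hz] := eqVneq (h z) 0; first by rewrite hz mul0r.
  by exfalso; apply: nz; exists z => //; rewrite lt0r hz h0.
have lnpE th z : Theta Kstar th -> Zs z -> 0 < h z ->
    ln (p th z) = ln (h z) + dotr (crd Kstar th) (t z) - phi (crd Kstar th).
  move=> Kth Zz hz; rewrite pE // /efam lnM ?posrE ?expR_gt0 // expRK; ring.
(* At [z0], [phi] is an affine function of the parameter minus [ln p], so (A2) makes it continuous
   on [C]. *)
have phiC x : C x -> forall e, 0 < e -> exists2 r, 0 < r &
    forall x', C x' -> `|x' - x| < r -> `|phi x' - phi x| <= e.
  move=> [th Kth <-] e e0.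
  have e2 : 0 < e / 2 by rewrite divr_gt0.
  have [r r0 Hr] := HA2 Kstar z0 Zz0 th Kth (e / 2) e2.
  pose G := \sum_(i < dim Kstar) `|t z0 ord0 i| + 1.
  have G0 : 0 < G by rewrite ltr_wpDl // sumr_ge0.
  exists (Num.min r (e / 2 / G)); first by rewrite lt_min r0 divr_gt0.
  move=> _ [th' Kth' <-]; rewrite lt_min => /andP[/(Hr _ Kth') l1 l2].
  move: l1; rewrite !lnpE //; set a := dotr _ _; set b := dotr _ _ => l1.
  have l3 : `|a - b| <= e / 2.
    rewrite /a /b -dotrBl; apply: le_trans (ler_norm_dotr _ _) _.
    apply: (@le_trans _ _ (e / 2 / G * G)); last by rewrite divfK ?gt_eqF.
    by rewrite ler_pM ?sumr_ge0 //; [exact: ltW|rewrite lerDl].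
  move: l1 l3; rewrite ltr_norml !ler_norml => /andP[l1 l1'] /andP[l3 l3'].
  apply/andP; split; lra.
have K1K : Theta Kstar.-1 `<=` Theta Kstar.
  case: (Kstar) => [|K] /=; [by []|exact: Hnest].
(* Working with a real [L] strictly below the infimum treats finite and infinite relative entropy
   together. *)
have LN L : (L%:E < relent_set Zs mu p (Theta Kstar.-1) pstar)%E ->
    (limn_esup (fun n => nlog n (P (Khat_lt p Theta pen Z n Kstar))) <= (- L)%:E)%E.
  move=> LH.
  have rate x : C x -> closure (crd Kstar @` Theta Kstar.-1) x ->
      exists s, [/\ 0 < s, s <= 1 &
        L < (phi x - phi (x + s *: (xs - x))) / s - phi x + phi xs].
    move=> [th Kth <-] clx.
    have [th1 Kth1 same] := closure_param_same_values K1K (HA1 Kstar.-1).1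
      (HA2 Kstar.-1) (HA2 Kstar) Kth clx.
    have p1E z : Zs z -> p th1 z = efam h t phi (crd Kstar th) z.
      move=> Zz; rewrite -pE //.
      (* Equality of logarithms determines the densities only where they are positive; where [h]
         vanishes both are zero. *)
      have [hz|hz] := eqVneq (h z) 0.
        by rewrite !pE //; [rewrite /efam hz !mul0r | exact: K1K].
      have hz0' : 0 < h z by rewrite lt0r hz h0.
      have pp th' : Theta Kstar th' -> p th' z \is Num.pos.
        by move=> Kth'; rewrite posrE pE // mulr_gt0 ?expR_gt0.
      apply: ln_inj; [exact/pp/K1K | exact: pp | exact: same].
    apply: (@relent_efam_slope _ _ _ Zs mu pstar (p th1) h t phi _ xs L) => //.
    - move=> s /andP[s0 s1]; apply: C1.
      rewrite (_ : _ + _ = s *: xs + (1 - s) *: crd Kstar th).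
        by apply: cvxC => //; rewrite s0.
      by rewrite scalerBr scalerBl scale1r addrCA.
    - by apply: Hnat_sub; exists th.
    - exact: (HH th1 (ex_intro _ _ Kth1)).1.
    - by apply: lt_le_trans LH _; apply: ereal_inf_lbound; exists th1.
  (* The penalty and the additive [1] each take half of [n * e]. *)
  have co e : 0 < e -> \forall n \near \oo, pen n Kstar + 1 <= n%:R * e.
    move=> e0; have e2 : 0 < e / 2 by rewrite divr_gt0.
    near=> n.
    have n0 : (0 < n)%N by near: n; exact: nbhs_infty_gt.
    have n1 : 1 / (e / 2) <= n%:R by near: n; exact: nbhs_infty_ger.
    have : pen n Kstar / n%:R < e / 2 by near: n; exact: (cvgr_lt _ (HA4o Kstar) _ e2).
    move: n1; rewrite ler_pdivrMr // ltr_pdivrMr ?ltr0n //; lra.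
  have [N HN] := near_maximizer_bound HZm mh h0 Ht HZmeas HZval law Hindep
    Hnat_open (Hnat_sub _ Cxs) (HA1 Kstar).1 (image_subset _ K1K) cvxC Cxs C1 phiC rate co.
  apply: (@limn_esup_nlog_le _ _ L N) => //.
  apply: filterS HN => n [B [mB PB HB]].
  (* Where [h] vanishes, [ln 0 = 0] breaks the affine formula for the log-likelihood; observations
     fall there with probability zero. Elsewhere the sum of the [ln (h (Z i w))] is common to all
     parameters and cancels. *)
  pose A0 := Zs `&` h @^-1` [set 0].
  have mA0 : measurable A0 by apply: mh.
  have PA0 i : measurable (Z i @^-1` A0) /\ (P (Z i @^-1` A0) <= 0%:E)%E.
    split; first by rewrite -[X in measurable X]setTI; exact: HZmeas.
    rewrite law // /dlaw integral0_eq // => z [[_ hz] _].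
    by rewrite /efam hz mul0r.
  have [mB0 PB0] := measure_bigsetU_le (index_enum 'I_n) (fun i : 'I_n => PA0 i).
  set B0 := \big[_/_]_(i <- _) _ in mB0 PB0.
  apply: (@le_trans _ _ (P (B `|` B0))).
    apply: le_measure; rewrite ?inE.
    - exact: measurable_Khat_lt.
    - exact: measurableU.
    move=> w Kw.
    have LU K th : Theta K th ->
        loglik p n (fun i => Z i w) th <= \sum_(i < n) u (Z i w).
      move=> Kth; apply: ler_sum => i _.
      by have /andP[] := HA3 th (Z i w) (ex_intro _ K Kth) (HZval i w).
    have [th' Kth' mx] := Khat_lt_near_maximizer Hnest (HA4pos n) Kths LU Kw.
    have [B0w|nB0w] := pselect (B0 w); [by right | left].
    have hpos (i : 'I_n) : 0 < h (Z i w).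
      rewrite lt0r h0 // andbT; apply/eqP => hz; apply: nB0w.
      by rewrite /B0 -bigcup_seq; exists i => //=; exact: mem_index_enum.
    have LLE th : Theta Kstar th -> loglik p n (fun i => Z i w) th =
        \sum_(i < n) ln (h (Z i w)) +
        (dotr (crd Kstar th) (\sum_(i < n) t (Z i w)) - n%:R * phi (crd Kstar th)).
      move=> Kth; rewrite /loglik (eq_bigr (fun i : 'I_n => ln (h (Z i w)) +
         (dotr (crd Kstar th) (t (Z i w)) - phi (crd Kstar th)))); last first.
        by move=> i _; rewrite lnpE // addrA.
      rewrite big_split /= sumrB sumr_const card_ord dotr_sumr; congr (_ + (_ - _)).
      by rewrite mulr_natl.
    apply: (HB w (crd Kstar th')); first by exists th'.
    move=> _ [th Kth <-]; have := mx th Kth.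
    rewrite (LLE th Kth) (LLE th' (K1K _ Kth')); lra.
  apply: le_trans (measureU2 _ mB mB0) _.
  rewrite -[leRHS]adde0; apply: leeD => //.
  by apply: le_trans PB0 _; rewrite mulr0.
(* A finite infimum is approached by [H - e]; for [+oo] every real [L] is admissible, which forces
   the limit to [-oo]; for [-oo] the bound is trivial. *)
case E : (relent_set _ _ _ _ _) => [H| |].
- rewrite -EFinN; apply/lee_addgt0Pr => e e0; rewrite -EFinD.
  apply: le_trans (LN (H - e) _) _; first by rewrite E lte_fin; lra.
  rewrite lee_fin; lra.
- move: LN; rewrite E; case: (limn_esup _) => [r| |] LN //.
    by have := LN (1 - r)%R (ltry _); rewrite lee_fin opprB lerBrDr gerDl ler10.
  by have := LN 0%R (ltry _).
- exact: leey.
Unshelve. all: by end_near. Qed.
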